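(* Let $m,n\in\mathbb{N}$, $q\in(-1,1)\setminus\{0\}$, and let $\alpha_\pm=p_\pm q_\pm$, $\beta_\pm=p_\pm+q_\pm$ with $p_\pm,q_\pm\in(-1,1)\setminus\{0\}$. For $\kappa\in\Lambda^{(m,n)}$ let $\xi_\kappa\in\mathbb{R}^m$ be the unique global minimizer of $V_\kappa$. Then: (i) the spectrum of $H$ in $\ell^2(\Lambda^{(n,m)},\Delta)$ consists of the eigenvalues $E(\xi_\kappa)$, $\kappa\in\Lambda^{(m,n)}$, where $E(\xi)=2(1-q)\sum_{1\le j\le m}\cos(\xi_j)$; (ii) the functions $\psi_{\xi_\kappa}$, $\kappa\in\Lambda^{(m,n)}$, form a basis of $\ell^2(\Lambda^{(n,m)},\Delta)$ consisting of eigenfunctions of $H$, with $H\psi_{\xi_\kappa}=E(\xi_\kappa)\psi_{\xi_\kappa}$ for all $\kappa\in\Lambda^{(m,n)}$.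
   Context: $\Lambda^{(n,m)}=\{\mu\in\mathbb{Z}^n\mid m\ge\mu_1\ge\cdots\ge\mu_n\ge0\}$ and $\Lambda^{(m,n)}=\{\kappa\in\mathbb{Z}^m\mid n\ge\kappa_1\ge\cdots\ge\kappa_m\ge0\}$; for $\mu\in\Lambda^{(n,m)}$ set $\mu_0\equiv m$, $\mu_{n+1}\equiv0$. Let $e_i$ be the standard unit vectors of $\mathbb{Z}^n$, $\delta_i=1$ if $i=0$ and $0$ otherwise. Hamiltonian: $(H\psi)(\mu)=\bigl(\beta_+(1-q^{m-\mu_1})+\beta_-(1-q^{\mu_n})\bigr)\psi(\mu)+\sum_{1\le i\le n,\ \mu+e_i\in\Lambda^{(n,m)}}(1-\alpha_+q^{m-\mu_1-1})^{\delta_{i-1}}(1-q^{\mu_{i-1}-\mu_i})\psi(\mu+e_i)+\sum_{1\le i\le n,\ \mu-e_i\in\Lambda^{(n,m)}}(1-\alpha_-q^{\mu_n-1})^{\delta_{n-i}}(1-q^{\mu_i-\mu_{i+1}})\psi(\mu-e_i)$. Hilbert space: with $(a;q)_0=1$, $(a;q)_l=\prod_{s=0}^{l-1}(1-aq^s)$, weights $\Delta_\mu=\frac{(q;q)_m}{(\alpha_+;q)_{m-\mu_1}(\alpha_-;q)_{\mu_n}\prod_{0\le i\le n}(q;q)_{\mu_i-\mu_{i+1}}}$ and inner product $\langle\psi,\phi\rangle_\Delta=\sum_{\mu}\psi(\mu)\overline{\phi(\mu)}\Delta_\mu$ on functions $\Lambda^{(n,m)}\to\mathbb{C}$. Conjugate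 partition: for $\mu\in\Lambda^{(n,m)}$, $\mu'\in\Lambda^{(m,n)}$ is the partition in which $i$ occurs exactly $\mu_i-\mu_{i+1}$ times ($i=0,\dots,n$). Hall-Littlewood polynomials: for $\lambda\in\Lambda^{(m,n)}$, $R_\lambda(\xi)=\sum_{\sigma\in S_m}\sum_{\epsilon\in\{\pm1\}^m}C(\epsilon_1\xi_{\sigma(1)},\dots,\epsilon_m\xi_{\sigma(m)})\exp\bigl({\rm i}\sum_{j=1}^m\epsilon_j\xi_{\sigma(j)}\lambda_j\bigr)$ with $C(\xi)=\prod_{j}\frac{1-\beta_+e^{-{\rm i}\xi_j}+\alpha_+e^{-2{\rm i}\xi_j}}{1-e^{-2{\rm i}\xi_j}}\prod_{j<k}\frac{(1-qe^{-{\rm i}(\xi_j-\xi_k)})(1-qe^{-{\rm i}(\xi_j+\xi_k)})}{(1-e^{-{\rm i}(\xi_j-\xi_k)})(1-e^{-{\rm i}(\xi_j+\xi_k)})}$, defined for $\xi$ with $2\xi_j,\xi_j\pm\xi_k\notin2\pi\mathbb{Z}$ ($j\neq k$); $R_\lambda$ is a symmetric polynomial in $\cos\xi_1,\dots,\cos\xi_m$ and is extended to all $\xi\in\mathbb{R}^m$ accordingly. Wave function: $\psi_\xi(\mu)=R_{\mu'}(\xi)$ for $\mu\in\Lambda^{(n,m)}$. Morse function: with $v_a(z)=\int_0^z\frac{(1-a^2)dx}{1-2a\cos x+a^2}$ ($-1<a<1$), $V_\kappa(\xi)=\sum_{j<k}\bigl(\int_0^{\xi_j+\xi_k}v_q+\int_0^{\xi_j-\xi_k}v_q\bigr)+\sum_j\bigl(n\xi_j^2-2\pi(m+1-j+\kappa_j)\xi_j+\int_0^{\xi_j}(v_{p_+}+v_{q_+}+v_{p_-}+v_{q_-})\bigr)$;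 it is strictly convex and radially unbounded, hence has a unique global minimizer. *)

(* Defs.v *)
From HB Require Import structures.
From mathcomp Require Import all_boot all_order all_algebra.
From mathcomp Require Import all_classical all_reals all_analysis.
From mathcomp Require Import fingroup perm complex.
Set Implicit Arguments. Unset Strict Implicit. Unset Printing Implicit Defensive.
Import Order.TTheory GRing.Theory Num.Theory.
Import numFieldNormedType.Exports.
Local Open Scope classical_set_scope.
Local Open Scope ring_scope.
Local Open Scope complex_scope.

Definition Lam (n m : nat) :=
  {t : n.-tuple 'I_m.+1 | sorted (fun a b : 'I_m.+1 => (b <= a)%N) t}.

(* the parts mu_1, ..., mu_n as a list (list position j-1 holds mu_j) *)
Definition parts n m (mu : Lam n m) : seq nat := map (@nat_of_ord _) (val mu).

(* paper indexing mu_k for k = 0..n+1, with mu_0 = m and mu_{n+1} = 0 *)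
Definition muk n m (mu : Lam n m) (k : nat) : nat :=
  if k == 0%N then m else if (k <= n)%N then nth 0%N (parts mu) k.-1 else 0%N.

Definition lamZ n m (mu : Lam n m) : seq int := map (fun k : nat => k%:Z) (parts mu).

Definition inLam (n m : nat) (s : seq int) : bool :=
  [&& size s == n, sorted (fun a b : int => b <= a) s
    & all (fun x : int => (0 <= x) && (x <= m%:Z)) s].

(* s +/- e_i (paper index i in 1..n), d = 1 or -1 *)
Definition shift (s : seq int) (i : nat) (d : int) : seq int :=
  set_nth 0 s i.-1 (nth 0 s i.-1 + d).

(* value of psi at the point of Lambda^(n,m) with integer coordinates s
   (0 if s is not in Lambda^(n,m); only used when it is) *)
Definition lookup (R : realType) n m (psi : Lam n m -> R[i]) (s : seq int) : R[i] :=
  match [pick nu : Lam n m | lamZ nu == s] with Some nu => psi nu | None => 0 end.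

Definition Hop (R : realType) n m (q pp qp pm qm : R)
    (psi : Lam n m -> R[i]) (mu : Lam n m) : R[i] :=
  let ap := pp * qp in let am := pm * qm in
  let bp := pp + qp in let bm := pm + qm in
  let M := muk mu in
  (bp * (1 - q ^+ (m - M 1%N)) + bm * (1 - q ^+ (M n)))%:C * psi mu
  + \sum_(1 <= i < n.+1 | inLam n m (shift (lamZ mu) i 1))
      (((if i == 1%N then 1 - ap * q ^+ (m - M 1%N - 1) else 1)
        * (1 - q ^+ (M i.-1 - M i)))%:C * lookup psi (shift (lamZ mu) i 1))
  + \sum_(1 <= i < n.+1 | inLam n m (shift (lamZ mu) i (-1)))
      (((if i == n then 1 - am * q ^+ (M n - 1) else 1)
        * (1 - q ^+ (M i - M i.+1)))%:C * lookup psi (shift (lamZ mu) i (-1))).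

Definition expi (R : realType) (t : R) : R[i] := cos t +i* sin t.

Definition Cfun (R : realType) m (q pp qp : R) (x : 'I_m -> R) : R[i] :=
  let ap := pp * qp in let bp := pp + qp in
  (\prod_(j < m)
     ((1 - bp%:C * expi (- x j) + ap%:C * expi (- (2 * x j)))
      / (1 - expi (- (2 * x j)))))
  * \prod_(j < m) \prod_(k < m | (j < k)%N)
     (((1 - q%:C * expi (- (x j - x k))) * (1 - q%:C * expi (- (x j + x k))))
      / ((1 - expi (- (x j - x k))) * (1 - expi (- (x j + x k))))).

(* R_lambda(xi) by the defining formula (meaningful for regular xi);
   lam_j is the list entry at position j-1 *)
Definition Rreg (R : realType) m (q pp qp : R) (lam : seq nat) (xi : 'rV[R]_m) : R[i] :=
  \sum_(s : 'S_m) \sum_(e : {ffun 'I_m -> bool})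
    let y := fun j : 'I_m => (if e j then -1 else 1) * xi ord0 (s j) in
    Cfun q pp qp y * expi (\sum_(j < m) y j * (nth 0%N lam j)%:R).

Definition regular (R : realType) m (xi : 'rV[R]_m) : Prop :=
  (forall (j : 'I_m) (l : int), 2 * xi ord0 j != 2 * pi * l%:~R) /\
  (forall (j k : 'I_m), j != k -> forall l : int,
      (xi ord0 j + xi ord0 k != 2 * pi * l%:~R) /\
      (xi ord0 j - xi ord0 k != 2 * pi * l%:~R)).

(* R_lambda extended to all of R^m by continuity (limit through regular points,
   which are dense; the extension is the polynomial in cos xi_j) *)
Definition Rfun (R : realType) m (q pp qp : R) (lam : seq nat) (xi : 'rV[R]_m) : R[i] :=
  (lim (@complex.Re R (Rreg q pp qp lam x) @[x --> within (@regular R m) (nbhs xi)]))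
  +i* (lim (@complex.Im R (Rreg q pp qp lam x) @[x --> within (@regular R m) (nbhs xi)])).

Definition conjpart n m (mu : Lam n m) : seq nat :=
  flatten [seq nseq (muk mu i - muk mu i.+1) i | i <- rev (iota 0 n.+1)].

Definition psi (R : realType) n m (q pp qp : R) (xi : 'rV[R]_m) (mu : Lam n m) : R[i] :=
  Rfun q pp qp (conjpart mu) xi.

Definition oint (R : realType) (f : R -> R) (a b : R) : R :=
  if a <= b then \int[lebesgue_measure]_(x in `[a, b]) f x
  else - \int[lebesgue_measure]_(x in `[b, a]) f x.

Definition va (R : realType) (a z : R) : R :=
  oint (fun x => (1 - a ^+ 2) / (1 - 2 * a * cos x + a ^+ 2)) 0 z.

(* V_kappa(xi), kappa in Lambda^(m,n); j 0-indexed so m+1-j_paper = m - j *)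
Definition Vmorse (R : realType) n m (q pp qp pm qm : R) (kappa : Lam m n)
    (xi : 'rV[R]_m) : R :=
  \sum_(j < m) \sum_(k < m | (j < k)%N)
     (oint (va q) 0 (xi ord0 j + xi ord0 k) + oint (va q) 0 (xi ord0 j - xi ord0 k))
  + \sum_(j < m)
     (n%:R * xi ord0 j ^+ 2
      - 2 * pi * (m - j + nth 0%N (parts kappa) j)%:R * xi ord0 j
      + oint (fun x => va pp x + va qp x + va pm x + va qm x) 0 (xi ord0 j)).

Definition Een (R : realType) m (q : R) (xi : 'rV[R]_m) : R :=
  2 * (1 - q) * \sum_(j < m) cos (xi ord0 j).

(* functions T -> C (the inner product <.,.>_Delta plays no role in these notions) *)

Definition spectrum (R : realType) (T : Type) (A : (T -> R[i]) -> (T -> R[i])) : set R[i] :=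
  [set l | ~ bijective (fun f : T -> R[i] => fun x => A f x - l * f x)].

Definition is_basis (R : realType) (I T : finType) (b : I -> T -> R[i]) : Prop :=
  (forall c : I -> R[i], (forall x, \sum_(i : I) c i * b i x = 0) -> forall i, c i = 0)
  /\ (forall f : T -> R[i], exists c : I -> R[i], forall x, f x = \sum_(i : I) c i * b i x).

(* Main.v *)
(* Extend R_lambda(xi) from partitions to a function F_xi of all lambda in Z^m, as the
   same sum over the hyperoctahedral group.  Pairing the summands w and w s for a
   simple reflection s shows that F_xi satisfies one linear relation per simple
   reflection of the finite Weyl group; the critical equation of V_kappa,
   exponentiated, is the Bethe equation, which is precisely what gives the analogous
   relation for the affine reflection lambda_1 -> 2n - lambda_1.
   Inside the alcove these relations convert the free Laplace equation
   sum_j F(lambda + e_j) + F(lambda - e_j) = 2 sum_j cos(xi_j) F(lambda)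
   into the eigenvalue equation for H.
   For completeness, the relations determine a function on Z^m by its restriction to
   the alcove.  So a linear dependence between the psi_(xi_kappa) propagates to all of
   Z^m, where it contradicts the linear independence of exponentials: the critical
   equation forces pi > xi_1 > ... > xi_m > 0, whence distinct kappa have disjoint free
   orbits, with nonzero coefficients C.  Conjugation of partitions makes the number of
   functions equal to the dimension. *)
Require Import Defs.
From HB Require Import structures.
From mathcomp Require Import all_boot all_order all_algebra.
From mathcomp Require Import all_classical all_reals all_analysis.
From mathcomp Require Import fingroup perm complex.
From mathcomp Require Import ring lra zify.
Import Order.TTheory GRing.Theory Num.Theory.
Import numFieldNormedType.Exports.
Local Open Scope classical_set_scope.
Local Open Scope ring_scope.
Local Open Scope complex_scope.
Set Implicit Arguments.
Unset Strict Implicit.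
Unset Printing Implicit Defensive.

(** * The Morse function *)

(** All that is used about a minimizer is its critical equation. The phase on its left is increasing
    in the coordinate xi_j, and comparing it with the values 2 pi (m - j + kappa_j), j counted from
    0, locates xi_kappa and recovers kappa. The location makes xi_kappa regular, so there the limit
    defining R is the value of the explicit sum. A relation on Z^m links several points, not just a
    point and its mirror image. Rewriting a value outside the alcove therefore yields other points,
    and a height function is needed to show that this ends. The factor 1 - q of E has a
    combinatorial origin. The partition lambda = mu' is constant on blocks of length mu_i -
    mu_(i+1). Raising different entries of one block gives values of F that differ by powers of q,
    and 1 - q times the resulting geometric sum is the coefficient 1 - q^(mu_i - mu_(i+1)) of H. The
    two moves that leave the alcove, above n and below 0, give the diagonal terms of H and its
    corrections by alpha. *)

Section RealDerivatives.
Variable R : realType.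
Implicit Types (f g : R -> R) (x : R).

Lemma is_derive_add f g x a b : is_derive x 1 f a -> is_derive x 1 g b ->
  is_derive x 1 (fun y => f y + g y) (a + b).
Proof. by move=> ? ?; exact: is_deriveD. Qed.

Lemma is_derive_sub f g x a b : is_derive x 1 f a -> is_derive x 1 g b ->
  is_derive x 1 (fun y => f y - g y) (a - b).
Proof. by move=> ? ?; exact: is_deriveB. Qed.

Lemma is_derive_scale f x c a : is_derive x 1 f a ->
  is_derive x 1 (fun y => c * f y) (c * a).
Proof. by move=> ?; exact: is_deriveZ. Qed.

Lemma is_derive_div f g x a b : g x != 0 -> is_derive x 1 f a ->
  is_derive x 1 g b ->
  is_derive x 1 (fun y => f y / g y) ((a * g x - f x * b) / g x ^+ 2).
Proof.
move=> gx0 fa gb.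
have vb : is_derive x 1 (fun y => (g y)^-1) (- (g x ^- 2 * b)).
  split; first exact/derivableV.
  by rewrite deriveV// derive_val /GRing.scale /= mulNr.
have H := is_deriveM fa vb; apply: (is_derive_eq H).
by rewrite /GRing.scale /=; field.
Qed.

Lemma is_derive_comp f g x a b : is_derive (g x) 1 f a -> is_derive x 1 g b ->
  is_derive x 1 (fun y => f (g y)) (a * b).
Proof. by move=> ? ?; exact: (@is_derive1_comp _ f g). Qed.

Lemma is_derive_big (I : finType) (P : pred I) (h : I -> R -> R) (dh : I -> R) x :
  (forall i, P i -> is_derive x 1 (h i) (dh i)) ->
  is_derive x 1 (fun y => \sum_(i | P i) h i y) (\sum_(i | P i) dh i).
Proof.
move=> H; have -> : (fun y => \sum_(i | P i) h i y) = \sum_(i | P i) h i.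
  by apply/funext => y; rewrite fct_sumE.
apply: (big_ind2 (fun f d => is_derive x 1 f d)) => //.
- exact: (@is_derive_cst _ _ _ (0 : R)).
- by move=> f a g b ? ?; exact: is_deriveD.
Qed.

Lemma is_derive_continuous f (a : R) x : is_derive x 1 f a -> {for x, continuous f}.
Proof. by move=> [d _]; apply/differentiable_continuous/derivable1_diffP. Qed.

End RealDerivatives.

(** * Closed form of the functions v_a *)

Section VaClosed.
Variable R : realType.
Implicit Types a x y : R.

(* Closed form of v_a, from exp (i v_a x) = e^(ix) (1 - a e^(-ix)) / (1 - a e^(ix)),
   so that v_a x = x + 2 arg (1 - a e^(-ix)). *)
Definition vatan a x : R := x + 2 * atan (a * sin x / (1 - a * cos x)).

Lemma poisson_den_gt0 a x : -1 < a < 1 -> 0 < 1 - a * cos x.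
Proof.
move=> ha; rewrite subr_gt0; apply: le_lt_trans (ler_norm _) _.
rewrite normrM; apply: (@le_lt_trans _ _ (`|a| * 1)).
  by rewrite ler_wpM2l// cos_max.
by rewrite mulr1 ltr_norml.
Qed.

(** The expression is affine in cos x, so it lies between (1 - a)^2 and (1 + a)^2; the sign of [a]
    decides which of the two is the lower bound. *)
Lemma poisson_den2_gt0 a x : -1 < a < 1 -> 0 < 1 - 2 * a * cos x + a ^+ 2.
Proof.
move=> ha; have h1 := cos_le1 x; have h2 := cos_geN1 x.
have p1 : 0 < (1 - a) ^+ 2 by rewrite exprn_gt0//; lra.
have p2 : 0 < (1 + a) ^+ 2 by rewrite exprn_gt0//; lra.
have [a0|/ltW a0] := leP 0 a.
  have : 0 <= a * (1 - cos x) by apply: mulr_ge0 => //; lra.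
  by move: p1; rewrite sqrrB expr1n; lra.
have : 0 <= - a * (1 + cos x) by apply: mulr_ge0; lra.
by move: p2; rewrite sqrrD expr1n; lra.
Qed.

Definition va' a x : R := (1 - a ^+ 2) / (1 - 2 * a * cos x + a ^+ 2).

Lemma va'_gt0 a x : -1 < a < 1 -> 0 < va' a x.
Proof.
move=> ha; rewrite divr_gt0 ?poisson_den2_gt0//.
by rewrite subr_gt0 -(expr1n _ 2) -real_normK ?num_real// ltrXn2r// ltr_norml.
Qed.

Lemma is_derive_vatan a x : -1 < a < 1 -> is_derive x 1 (vatan a) (va' a x).
Proof.
move=> ha; rewrite /vatan.
have D0 := poisson_den_gt0 x ha; have D20 := poisson_den2_gt0 x ha.
have Dn0 : 1 - a * cos x != 0 by rewrite gt_eqF.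
have D2n0 : 1 - 2 * a * cos x + a ^+ 2 != 0 by rewrite gt_eqF.
have e := cos2Dsin2 x.
have dq : is_derive x 1 (fun y => a * sin y / (1 - a * cos y))
   ((a * cos x - a ^+ 2) / (1 - a * cos x) ^+ 2).
  have ds := is_derive_scale a (is_derive_sin x).
  have dc := is_derive_sub (is_derive_cst (1:R) x 1)
               (is_derive_scale a (is_derive_cos x)).
  apply: (is_derive_eq (@is_derive_div R _ (fun y => 1 - a * cos y) x _ _ Dn0 ds dc)).
  congr (_ / _).
  transitivity (a * cos x - a ^+ 2 * (cos x ^+ 2 + sin x ^+ 2)); first by ring.
  by rewrite e mulr1.
have dat := is_derive_scale 2 (is_derive_comp (is_derive1_atan _) dq).
apply: (is_derive_eq (is_derive_add (is_derive_id x 1) dat)).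
have D3 : (1 - a * cos x) ^+ 2 + (a * sin x) ^+ 2 = 1 - 2 * a * cos x + a ^+ 2.
  transitivity (1 - 2 * a * cos x + a ^+ 2 * (cos x ^+ 2 + sin x ^+ 2)).
    by ring.
  by rewrite e mulr1.
have E : 1 + (a * sin x / (1 - a * cos x)) ^+ 2 =
  (1 - 2 * a * cos x + a ^+ 2) / (1 - a * cos x) ^+ 2.
  by rewrite -D3; field.
rewrite E /va'; field.
by rewrite Dn0 D2n0.
Qed.

Lemma vatan0 a : vatan a 0 = 0.
Proof. by rewrite /vatan sin0 mulr0 mul0r atan0 mulr0 addr0. Qed.

Lemma vatanN a x : vatan a (- x) = - vatan a x.
Proof. by rewrite /vatan sinN cosN mulrN mulNr atanN; ring. Qed.

Lemma vatanD2pi a x : vatan a (x + 2 * pi) = vatan a x + 2 * pi.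
Proof. by rewrite /vatan mulr_natl sinD2pi cosD2pi addrAC. Qed.

Lemma vatan_lt a x y : -1 < a < 1 -> x < y -> vatan a x < vatan a y.
Proof.
move=> ha xy.
have d z : z \in `]x, y[ -> is_derive z 1 (vatan a) (va' a z).
  by move=> _; exact: is_derive_vatan.
have [|c _ e] := MVT xy d.
  by apply: continuous_subspaceT => z; exact: is_derive_continuous (is_derive_vatan _ ha).
by rewrite -subr_gt0 e mulr_gt0 ?va'_gt0// subr_gt0.
Qed.

Lemma vatan_le a x y : -1 < a < 1 -> x <= y -> vatan a x <= vatan a y.
Proof. by move=> ha; rewrite le_eqVlt => /predU1P[->//|/(vatan_lt ha)/ltW]. Qed.

End VaClosed.

Section Oint.
Variable R : realType.
Implicit Types (f F g : R -> R) (a b x : R).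

Lemma oint_FTC2 f F a b : continuous f -> (forall x, is_derive x 1 F (f x)) ->
  oint f a b = F b - F a.
Proof.
move=> cf dF.
have key u v : u < v -> \int[lebesgue_measure]_(x in `[u, v]) f x = F v - F u.
  move=> uv; rewrite /Rintegral (@continuous_FTC2 _ f F)//.
  - exact: continuous_subspaceT.
  - split; first by move=> x _; have [] := dF x.
    + by apply: cvg_at_right_filter; exact: is_derive_continuous (dF u).
    + by apply: cvg_at_left_filter; exact: is_derive_continuous (dF v).
  - by move=> x _; rewrite derive1E; have [_ ->] := dF x.
rewrite /oint; case: leP => [|ab]; last by rewrite key// opprB.
rewrite le_eqVlt => /predU1P[->|/key//].
by rewrite set_itv1 Rintegral_set1 subrr.
Qed.

Lemma is_derive_oint f x : continuous f -> is_derive x 1 (oint f 0) (f x).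
Proof.
move=> cf.
have itg u v : lebesgue_measure.-integrable `[u, v] (EFin \o f).
  apply: continuous_compact_integrable; first exact: segment_compact.
  exact: continuous_subspaceT.
(* One primitive, based to the left of 0 and x, serves both orientations. *)
have [c [c0 cx]] : exists c : R, c < 0 /\ c < x.
  by have [h|h] := leP 0 x; [exists (-1)|exists (x - 1)]; split; lra.
pose G y := \int[lebesgue_measure]_(t in `[c, y]) f t.
have dG y : c < y -> is_derive y 1 G (f y).
  move=> cy; have y1 : y < y + 1 by rewrite ltrDl.
  have [] := continuous_FTC1_closed y1 (itg _ _) cy (cf y).
  by move=> d e; split; [exact: d|rewrite -derive1E; exact: e].
have key u v : c < u -> u <= v -> \int[lebesgue_measure]_(t in `[u, v]) f t = G v - G u.
  move=> cu uv; rewrite /G Rintegral_itvB ?bnd_simp ?(ltW cu)//.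
  rewrite Rintegral_itv_obnd_cbnd//; apply: integrableS (itg u v) => //.
  exact: subset_itv_oc_cc.
have E y : c < y -> oint f 0 y = G y - G 0.
  move=> cy; rewrite /oint; case: leP => [y0|/ltW y0]; rewrite key// opprB//.
have H : is_derive x 1 (fun y => G y - G 0) (f x).
  rewrite -[f x]subr0; apply: is_derive_sub (dG _ cx) _; exact: is_derive_cst.
apply: near_eq_is_derive H.
near=> y; apply/esym/E; near: y; apply: (cvgr_gt x) cx; exact: cvg_id.
Unshelve. all: by end_near.
Qed.

End Oint.

(** * The critical equation and the location of its solutions *)

Section BetheVector.
Variable R : realType.

Lemma va_vatan (a : R) : -1 < a < 1 -> va a = vatan a.
Proof.
move=> ha; apply/funext => z.
have cf : continuous (va' a).
  move=> x; have d1 := is_derive_cst (1 - a ^+ 2) x (1 : R).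
  have d2 := is_derive_sub (is_derive_cst (1:R) x 1)
               (is_derive_scale (2 * a) (is_derive_cos x)).
  have d3 := is_derive_add d2 (is_derive_cst (a ^+ 2) x 1).
  have Dn0 : 1 - 2 * a * cos x + a ^+ 2 != 0 by rewrite gt_eqF ?poisson_den2_gt0.
  exact: (is_derive_continuous (@is_derive_div R (fun=> 1 - a ^+ 2)
    (fun y => 1 - 2 * a * cos y + a ^+ 2) x _ _ Dn0 d1 d3)).
rewrite /va (oint_FTC2 0 z cf (fun x => is_derive_vatan x ha)).
by rewrite vatan0 subr0.
Qed.

(** The interaction in V is a sum over pairs k < l. Its derivative along coordinate [j] sees only
    the pairs containing [j], as first or as second member; both kinds merge into one sum over the
    other index. *)
Lemma sum_lt_delta (m : nat) (B : 'I_m -> 'I_m -> R) (j : 'I_m) :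
  \sum_(k < m) \sum_(l < m | (k < l)%N)
     (B k l * (k == j)%:R + B l k * (l == j)%:R) = \sum_(l < m | l != j) B j l.
Proof.
have -> : \sum_(k < m) \sum_(l < m | (k < l)%N)
     (B k l * (k == j)%:R + B l k * (l == j)%:R) =
  \sum_(k < m) \sum_(l < m | (k < l)%N) B k l * (k == j)%:R +
  \sum_(l < m) \sum_(k < m | (k < l)%N) B l k * (l == j)%:R.
  rewrite [X in _ = _ + X](exchange_big_dep xpredT)//= -big_split /=.
  by apply: eq_bigr => k _; rewrite big_split.
rewrite -big_split /= (bigD1 j)//= [X in _ + X]big1 ?addr0.
  rewrite [RHS](bigID (fun l : 'I_m => (j < l)%N)) /= eqxx; congr (_ + _).
    apply: eq_big => l; rewrite ?mulr1//.
    by rewrite -val_eqE /=; lia.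
  apply: eq_big => l; rewrite ?mulr1//.
  by rewrite -val_eqE /=; lia.
move=> k /negbTE ->; rewrite !big1 ?addr0// => i _; exact: mulr0.
Qed.

Variables (m n : nat) (q pp qp pm qm : R).
Hypotheses (hq : -1 < q < 1) (hpp : -1 < pp < 1) (hqp : -1 < qp < 1)
  (hpm : -1 < pm < 1) (hqm : -1 < qm < 1).

Definition bphase (x : R) : R := vatan pp x + vatan qp x + vatan pm x + vatan qm x.

Definition qphase (x y : R) : R := vatan q (x + y) + vatan q (x - y).

(* The j-th partial derivative of V_kappa, up to its constant term. *)
Definition bethe_phase (x : 'rV[R]_m) (j : 'I_m) : R :=
  \sum_(l < m | l != j) qphase (x ord0 j) (x ord0 l)
  + 2 * n%:R * x ord0 j + bphase (x ord0 j).

Definition bethe_vector (kappa : Lam m n) (x : 'rV[R]_m) : Prop :=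
  forall j : 'I_m,
    bethe_phase x j = 2 * pi * (m - j + nth 0%N (parts kappa) j)%:R.

Lemma vatan_continuous (a : R) : -1 < a < 1 -> continuous (vatan a).
Proof. by move=> ha x; exact: is_derive_continuous (is_derive_vatan x ha). Qed.

Lemma is_derive_bphase (x : R) : is_derive x 1 bphase
  (va' pp x + va' qp x + va' pm x + va' qm x).
Proof.
by do 3![apply: is_derive_add; last exact: is_derive_vatan]; exact: is_derive_vatan.
Qed.

(** Along the line through [x] in direction e_j, V becomes a function of one variable with a minimum
    at 0, so its derivative vanishes there. *)
Lemma minimizer_bethe_vector (kappa : Lam m n) (x : 'rV[R]_m) :
  (forall y, Vmorse q pp qp pm qm kappa x <= Vmorse q pp qp pm qm kappa y) ->
  bethe_vector kappa x.
Proof.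
move=> hx j.
pose c (k : 'I_m) : R := (k == j)%:R.
pose xt (t : R) := x + t *: delta_mx 0 j.
have xtE t k : xt t ord0 k = x ord0 k + c k * t.
  by rewrite !mxE eqxx /c mulrC.
have cq := vatan_continuous hq.
have cb : continuous bphase by move=> y; exact: is_derive_continuous (is_derive_bphase y).
pose f t := Vmorse q pp qp pm qm kappa (xt t).
have dlin (t : R) k : is_derive t 1 (fun t : R => x ord0 k + c k * t) (c k).
  rewrite -[X in is_derive _ _ _ X]add0r -[c k in X in is_derive _ _ _ X]mulr1.
  exact: is_derive_add (is_derive_cst _ _ _) (is_derive_scale _ (is_derive_id _ _)).
pose D (y : 'rV[R]_m) : R := let x' k := y ord0 k in
  \sum_(k < m) \sum_(l < m | (k < l)%N)
     (vatan q (x' k + x' l) * (c k + c l) + vatan q (x' k - x' l) * (c k - c l))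
  + \sum_(k < m) (n%:R * (2 * x' k * c k)
       - 2 * pi * (m - k + nth 0%N (parts kappa) k)%:R * c k + bphase (x' k) * c k).
have df (t : R) : is_derive t 1 f (D (xt t)).
  rewrite /f /D /Vmorse (va_vatan hq) (va_vatan hpp) (va_vatan hqp) (va_vatan hpm)
    (va_vatan hqm).
  apply: is_derive_add.
    apply: is_derive_big => k _; apply: is_derive_big => l _.
    have -> : (fun y => oint (vatan q) 0 (xt y ord0 k + xt y ord0 l) +
        oint (vatan q) 0 (xt y ord0 k - xt y ord0 l)) =
      (fun y => oint (vatan q) 0 ((x ord0 k + c k * y) + (x ord0 l + c l * y)) +
        oint (vatan q) 0 ((x ord0 k + c k * y) - (x ord0 l + c l * y))).
      by apply/funext => y; rewrite !xtE.
    apply: is_derive_add.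
      by rewrite !xtE; exact: (is_derive_comp (is_derive_oint _ cq)
        (is_derive_add (dlin t k) (dlin t l))).
    by rewrite !xtE; exact: (is_derive_comp (is_derive_oint _ cq)
      (is_derive_sub (dlin t k) (dlin t l))).
  apply: is_derive_big => k _.
  set K := 2 * pi * _.
  have -> : (fun y => n%:R * xt y ord0 k ^+ 2 - K * xt y ord0 k + oint bphase 0 (xt y ord0 k))
   = (fun y => n%:R * (x ord0 k + c k * y) ^+ 2 - K * (x ord0 k + c k * y) +
        oint bphase 0 (x ord0 k + c k * y)).
    by apply/funext => y; rewrite !xtE.
  have H2 : is_derive t 1 (fun y => (x ord0 k + c k * y) ^+ 2)
      (2 * (x ord0 k + c k * t) * c k).
    have H := is_deriveX 2 (dlin t k).
    by apply: (is_derive_eq H); rewrite /GRing.scale /= expr1.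
  rewrite !xtE.
  exact: (is_derive_add (is_derive_sub (is_derive_scale n%:R H2)
    (is_derive_scale K (dlin t k))) (is_derive_comp (is_derive_oint _ cb) (dlin t k))).
have x0 : xt 0 = x by rewrite /xt scale0r addr0.
have /= D0 : D (xt 0) = 0.
  have m1 : (0 : R) \in `]-1, 1[ by rewrite in_itv /=; lra.
  have le11 : (-1 : R) <= 1 by lra.
  have dd t : t \in `](-1 : R), 1[ -> derivable f t 1 by move=> _; have [] := df t.
  have [|_ H0] := @derive1_at_min R f (-1) 1 0 le11 dd m1.
    by move=> t _; rewrite /f x0.
  by have [_ e] := df 0; rewrite -e; exact: H0.
move: D0; rewrite x0 /D.
(* As [vatan q] is odd, the term of a pair splits into [qphase] seen from [k] times [c k] plus
   [qphase] seen from [l] times [c l]. *)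
rewrite (eq_bigr (fun k : 'I_m => \sum_(l < m | (k < l)%N)
   (qphase (x ord0 k) (x ord0 l) * (k == j)%:R +
    qphase (x ord0 l) (x ord0 k) * (l == j)%:R))); last first.
  move=> k _; apply: eq_bigr => l _.
  rewrite /qphase -(opprB (x ord0 k) (x ord0 l)) vatanN (addrC (x ord0 l)) /c.
  by ring.
rewrite sum_lt_delta [X in _ + X = _](bigD1 j)//= [X in _ + (_ + X)]big1; last first.
  by move=> k /negbTE kj; rewrite /c kj !mulr0 subrr addr0.
rewrite /c eqxx !mulr1 /bethe_phase => D0.
apply: subr0_eq; rewrite -[RHS]D0; ring.
Qed.

Lemma qphase_le (x x' y : R) : x <= x' -> qphase x y <= qphase x' y.
Proof. by move=> h; apply: lerD; apply: vatan_le => //; rewrite lerD2r. Qed.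

Lemma bphase_le (x x' : R) : x <= x' -> bphase x <= bphase x'.
Proof.
by move=> h; do 3![apply: lerD; last exact: vatan_le]; exact: vatan_le.
Qed.

Lemma vatan_pi (a : R) : vatan a pi = pi.
Proof.
have := vatanD2pi a (- pi); rewrite vatanN.
have -> : - pi + 2 * pi = pi :> R by ring.
lra.
Qed.

Section Location.
Variables (kappa : Lam m n) (x : 'rV[R]_m).
Hypothesis bx : bethe_vector kappa x.

(** Each term of the phase increases with x_j and vanishes at x_j = 0, whereas the right side of the
    equation is at least 2 pi (m - j) > 0. *)
Lemma bethe_vector_gt0 (j : 'I_m) : 0 < x ord0 j.
Proof.
rewrite ltNge; apply/negP => xj.
have : 0 < bethe_phase x j.
  by rewrite bx !mulr_gt0 ?pi_gt0// ltr0n addn_gt0 subn_gt0 ltn_ord.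
apply/negP; rewrite -leNgt /bethe_phase.
rewrite -[X in _ <= X]addr0 -[X in _ <= X + _]addr0; apply: lerD; first apply: lerD.
- apply: sumr_le0 => l _; apply: le_trans (qphase_le _ xj) _.
  by rewrite /qphase add0r sub0r vatanN subrr.
- by apply: mulr_ge0_le0 => //; rewrite mulr_ge0.
- by apply: le_trans (bphase_le xj) _; rewrite /bphase !vatan0 !addr0.
Qed.

Lemma parts_le (j : nat) : (nth 0%N (parts kappa) j <= n)%N.
Proof.
have [jm|jm] := ltnP j (size (parts kappa)); last by rewrite nth_default.
rewrite (nth_map ord0); last by move: jm; rewrite size_map.
by rewrite -ltnS ltn_ord.
Qed.

(** At x_j >= pi, each of the m - 1 interactions is at least v_q(pi + y) + v_q(pi - y) = 2 pi, the
    linear term at least 2 pi n and the boundary phase at least 4 pi. Their sum 2 pi (m + n + 1)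
    exceeds the largest possible right side, 2 pi (m + n). *)
Lemma bethe_vector_ltpi (j : 'I_m) : x ord0 j < pi.
Proof.
rewrite ltNge; apply/negP => xj.
have Hlt : bethe_phase x j <= 2 * pi * (m + n)%:R.
  rewrite bx ler_wpM2l ?mulr_ge0 ?pi_ge0// ler_nat.
  by apply: leq_add; [exact: leq_subr|exact: parts_le].
move: Hlt; apply/negP; rewrite -ltNge /bethe_phase.
have h1 : 2 * pi * (m.-1)%:R <= \sum_(l < m | l != j) qphase (x ord0 j) (x ord0 l).
  rewrite -[X in (X.-1)%:R](card_ord m) (cardD1 j) inE /= -sum1_card natr_sum mulr_sumr.
  under [leLHS]eq_bigl do rewrite !inE andbT.
  apply: ler_sum => l _; rewrite mulr1; apply: le_trans (qphase_le _ xj).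
  rewrite /qphase -(opprB _ pi) vatanN -[X in vatan q (X + _)](_ : - pi + 2 * pi = _); last by ring.
  have -> : - pi + 2 * pi + x ord0 l = x ord0 l - pi + 2 * pi by ring.
  by rewrite vatanD2pi addrAC subrr add0r.
have h2 : 2 * n%:R * pi <= 2 * n%:R * x ord0 j by rewrite ler_wpM2l ?mulr_ge0.
have h3 : 4 * pi <= bphase (x ord0 j).
  by apply: le_trans (bphase_le xj); rewrite /bphase !vatan_pi; lra.
have m0 : (0 < m)%N := leq_ltn_trans (leq0n j) (ltn_ord j).
have e : (m + n)%:R = (m.-1)%:R + 1 + n%:R :> R.
  by rewrite -{1}(prednK m0) natrD -natr1.
rewrite e; have := pi_gt0 R; nra.
Qed.

Lemma parts_sorted (j k : 'I_m) : (j < k)%N ->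
  (nth 0%N (parts kappa) k <= nth 0%N (parts kappa) j)%N.
Proof.
move=> jk; rewrite /parts.
case: kappa => t /= st; have szt := size_tuple t.
rewrite !(nth_map ord0) ?szt//.
by apply: (sorted_ltn_nth (leT := fun a b : 'I_n.+1 => (b <= a)%N)) => //;
   rewrite ?inE ?szt// => b a c ba cb; exact: leq_trans cb ba.
Qed.

(** If x_j <= x_k, monotonicity makes the phase at [j] at most the phase at [k], but m - j + kappa_j
    is strictly decreasing in j. *)
Lemma bethe_vector_decr (j k : 'I_m) : (j < k)%N -> x ord0 k < x ord0 j.
Proof.
move=> jk; rewrite ltNge; apply/negP => xjk.
have jnk : j != k by rewrite -val_eqE /= ltn_eqF.
have : bethe_phase x k < bethe_phase x j.
  rewrite !bx ltr_pM2l ?mulr_gt0 ?pi_gt0// ltr_nat.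
  by rewrite -addSn leq_add ?parts_sorted// ltn_sub2l// (ltn_trans jk).
apply/negP; rewrite -leNgt /bethe_phase; apply: lerD; last exact: bphase_le.
apply: lerD; last by rewrite ler_wpM2l ?mulr_ge0.
(* The mutual interaction of [j] and [k] is compared apart: both sides share v_q(x_j + x_k), and
   v_q(x_j - x_k) <= v_q(x_k - x_j). *)
rewrite (bigD1 k) 1?eq_sym//= [leRHS](bigD1 j)//=; apply: lerD.
  rewrite /qphase (addrC (x ord0 k) (x ord0 j)) lerD2l.
  by apply: vatan_le => //; rewrite lerD// lerN2.
under [leRHS]eq_bigl do rewrite andbC.
by apply: ler_sum => l _; exact: qphase_le.
Qed.

End Location.

Lemma bethe_vector_inj (kappa kappa' : Lam m n) (x : 'rV[R]_m) :
  bethe_vector kappa x -> bethe_vector kappa' x -> kappa = kappa'.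
Proof.
move=> b b'; apply/val_inj/val_inj/(inj_map val_inj).
have sz (k : Lam m n) : size (parts k) = m by rewrite size_map size_tuple.
apply: (@eq_from_nth _ 0%N); first by rewrite !sz.
move=> i; rewrite sz => im; have := b (Ordinal im); rewrite b'.
move/mulfI => H; have := H _; rewrite mulf_neq0 ?gt_eqF ?pi_gt0// => /(_ isT)/eqP.
by rewrite eqr_nat eqn_add2l => /eqP.
Qed.

End BetheVector.

(** * Affine reflection relations *)

(* Points of Z^m are sequences l : nat -> int, of which only the coordinates
   0, ..., m-1 matter. *)
Definition upd (l : nat -> int) (j : nat) (a : int) : nat -> int :=
  fun k => if k == j then a else l k.

Definition upd2 (l : nat -> int) (j : nat) (a b : int) : nat -> int :=
  upd (upd l j.+1 b) j a.

Lemma upd_id l j : upd l j (l j) = l.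
Proof. by apply/funext => k; rewrite /upd; case: eqP => // ->. Qed.

Lemma upd2_id l j : upd2 l j (l j) (l j.+1) = l.
Proof. by rewrite /upd2 upd_id upd_id. Qed.

Section Vanishing.
Variables (K : numFieldType) (m n : nat) (q ap bp am bm : K).
Variable F : (nat -> int) -> K.
Hypothesis n_gt0 : (0 < n)%N.

(* With t_j the shift of the j-th coordinate: (1 - q t_j t_(j+1)^-1) F is odd for
   the reflection exchanging l_j and l_(j+1) - 1, (t^-1 - bp + ap t) F is odd for
   the reflection of the last coordinate in 0, and (t - bm + am t^-1) F is odd for
   the reflection of the first coordinate in n. *)
Definition rel_swap := forall l j a b, (j.+1 < m)%N ->
  F (upd2 l j a b) - q * F (upd2 l j (a + 1) (b - 1))
  + F (upd2 l j (b - 1) (a + 1)) - q * F (upd2 l j b a) = 0.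

Definition rel_left := forall l k, (0 < m)%N ->
  let f x := F (upd l m.-1 x) in
  (f (k - 1) - bp * f k + ap * f (k + 1))
  + (f (- k - 1) - bp * f (- k) + ap * f (- k + 1)) = 0.

Definition rel_right := forall l k, (0 < m)%N ->
  let f x := F (upd l 0%N x) in
  (f (n%:Z + k + 1) - bm * f (n%:Z + k) + am * f (n%:Z + k - 1))
  + (f (n%:Z - k + 1) - bm * f (n%:Z - k) + am * f (n%:Z - k - 1)) = 0.

Hypotheses (Rs : rel_swap) (Rl : rel_left) (Rr : rel_right).

Definition dominant (l : nat -> int) :=
  (forall j, (j.+1 < m)%N -> l j.+1 <= l j) /\
  (forall j, (j < m)%N -> 0 <= l j <= n%:Z).

(* Each relation of the alcove reflections rewrites F at a point outside the
   alcove in terms of F at points of strictly smaller height. *)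
Let ht (j : nat) (x : int) : int := m%:Z * (2 * x - n%:Z) ^+ 2 + j%:Z * x.
Let height (l : nat -> int) : int := \sum_(0 <= j < m) ht j (l j).

(** For negative x the linear term is at least -m |x|, and |x| <= (2x - n)^2 for integers. *)
Lemma ht_ge0 j x : (j <= m)%N -> 0 <= ht j x.
Proof.
rewrite /ht => jm; have [x0|x0] := leP 0 x.
  by apply: addr_ge0; apply: mulr_ge0; rewrite ?sqr_ge0 ?le0z_nat.
have h : - x <= (2 * x - n%:Z) ^+ 2 by nia.
have h2 : m%:Z * - x <= m%:Z * (2 * x - n%:Z) ^+ 2 by rewrite ler_wpM2l ?le0z_nat.
nia.
Qed.

Lemma height_ge0 l : 0 <= height l.
Proof.
rewrite /height big_nat; apply: sumr_ge0 => j /andP[_ jm].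
by apply: ht_ge0; exact: ltnW.
Qed.

Lemma height_upd l j a : (j < m)%N -> height (upd l j a) = height l - ht j (l j) + ht j a.
Proof.
move=> jm; have u : j \in index_iota 0 m by rewrite mem_index_iota.
rewrite /height !(bigD1_seq j)//= ?iota_uniq//.
rewrite {1}/upd eqxx (eq_bigr (fun k => ht k (l k))); last first.
  by move=> k /negbTE kj; rewrite /upd kj.
ring.
Qed.

Lemma height_upd2 l j a b : (j.+1 < m)%N ->
  height (upd2 l j a b) = height l - ht j (l j) - ht j.+1 (l j.+1) + ht j a + ht j.+1 b.
Proof.
move=> jm; have jm' := ltnW jm; rewrite !height_upd//.
by rewrite {1}/upd (ltn_eqF (ltnSn j)); ring.
Qed.

(** Strong induction on the height. Its quadratic part is centred at n/2, midway between the walls 0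
    and n, and falls when a coordinate is moved back inwards. Exchanging an ascending pair preserves
    the quadratic part and lowers the linear part, thanks to the weight [j]. The factor [m] lets the
    quadratic part outweigh the linear one, whose weights are below [m]. *)
Lemma relations_vanish : (forall l, dominant l -> F l = 0) -> forall l, F l = 0.
Proof.
move=> F0 l; have [N] := ubnP `|height l|%N.
elim: N l => // N IH l; rewrite ltnS => lN.
have {}IH l' : height l' < height l -> F l' = 0.
  by move=> h; apply: IH; have := height_ge0 l'; lia.
have [[j [jm lj]]|up] := pselect (exists j, (j.+1 < m)%N /\ l j < l j.+1).
  (* In this case the four terms of the relation coincide in pairs, and it reads 2 (F(l) - q F(l'))
     = 0 with l' the exchanged, lower point. *)
  have [e|ne] := eqVneq (l j.+1) (l j + 1).
    have := Rs l (l j) (l j.+1) jm; rewrite upd2_id e addrK -e upd2_id.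
    rewrite [F (upd2 _ _ _ _)]IH; last first.
      rewrite height_upd2// [ltLHS](_ : _ = height l - (l j.+1 - l j)); first lia.
      by rewrite /ht -natr1; ring.
    by move: (F l) => x /eqP; rewrite mulr0 !subr0 -mulr2n mulrn_eq0/= => /eqP.
  (* The gap is now at least 2; this is the drop of the quadratic part when both entries move one
     step towards each other. *)
  have h8 : 0 < m%:Z * 8 * (l j.+1 - l j - 1) by nia.
  have := Rs l (l j) (l j.+1) jm; rewrite upd2_id.
  rewrite ![F (upd2 _ _ _ _)]IH.
  - by rewrite !mulr0 !subr0 addr0.
  - rewrite height_upd2// [ltLHS](_ : _ = height l - (l j.+1 - l j)); first lia.
    by rewrite /ht -natr1; ring.
  - rewrite height_upd2//.
    rewrite [ltLHS](_ : _ = height l - m%:Z * 8 * (l j.+1 - l j - 1) - (l j.+1 - l j - 1)).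
      by clear -h8 lj; lia.
    by rewrite /ht -natr1; ring.
  - rewrite height_upd2//.
    rewrite [ltLHS](_ : _ = height l - m%:Z * 8 * (l j.+1 - l j - 1) - 1).
      by clear -h8 lj; lia.
    by rewrite /ht -natr1; ring.
have {}up j : (j.+1 < m)%N -> l j.+1 <= l j.
  by move=> jm; rewrite leNgt; apply/negP => h; apply: up; exists j.
have [m0|m0] := posnP m; first by apply: F0; split=> j; rewrite m0.
have [hl|hl] := ltP (l m.-1) 0.
  have hm : (m.-1 < m)%N by rewrite prednK.
  set x := l m.-1 in hl.
  (* At the endpoint y = -x the positivity of [n] matters: the quadratic part drops by 8 m n |x|,
     while the linear part grows by only 2 (m - 1) |x|. *)
  have low y : x < y -> y <= - x -> F (upd l m.-1 y) = 0.
    move=> xy yx; apply: IH; rewrite height_upd// /ht.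
    have : m%:Z * ((2 * y - n%:Z) ^+ 2) + m%:Z * (y - x) <= m%:Z * ((2 * x - n%:Z) ^+ 2).
      by rewrite -mulrDr ler_wpM2l ?le0z_nat//; nia.
    have : (m.-1)%:Z * (y - x) < m%:Z * (y - x) by rewrite ltr_pM2r ?subr_gt0// ltz_nat.
    rewrite -/x !mulrBr; lia.
  (* This k makes [x] the lowest point of the relation, all others lying in the range of [low]. For
     x = -1 it is k = 0, and the relation is twice one expression. *)
  have := Rl l (- x - 1) m0 => /=.
  have -> : - (- x - 1) - 1 = x by ring.
  rewrite [upd l m.-1 x]upd_id; have [x1|x1] := eqVneq x (-1).
    rewrite x1 subrr sub0r oppr0 -x1 upd_id !low; [|lia..].
    move: (F l) => Fl /eqP.
    by rewrite !mulr0 subr0 addr0 -mulr2n mulrn_eq0/= => /eqP.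
  rewrite !low; [|lia..].
  by rewrite !mulr0 !(subr0, addr0, add0r).
have [hr|hr] := ltP n%:Z (l 0%N).
  set x := l 0%N in hr.
  have low y : n%:Z - x < y -> y < x -> F (upd l 0%N y) = 0.
    move=> xy yx; apply: IH; rewrite height_upd// /ht !mul0r !addr0 -/x.
    have : m%:Z * ((2 * y - n%:Z) ^+ 2) < m%:Z * ((2 * x - n%:Z) ^+ 2).
      by rewrite ltr_pM2l ?ltz_nat//; nia.
    lia.
  (* Here [x] is the highest point of the relation; again k = 0 in the adjacent case x = n + 1. *)
  have := Rr l (x - n%:Z - 1) m0 => /=.
  have -> : n%:Z + (x - n%:Z - 1) + 1 = x by ring.
  rewrite [upd l 0%N x]upd_id; have [x1|x1] := eqVneq x (n%:Z + 1).
    have -> : x - n%:Z - 1 = 0 by rewrite x1; ring.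
    rewrite !addr0 ?subr0 -x1 upd_id !low; [|lia..].
    move: (F l) => Fl /eqP.
    by rewrite !mulr0 subr0 addr0 -mulr2n mulrn_eq0/= => /eqP.
  rewrite !low; [|lia..].
  by rewrite !mulr0 !(subr0, addr0, add0r).
apply: F0; split=> // j jm.
have h0 : forall k, (k < m)%N -> l k <= l 0%N.
  by elim=> // k Ik km; apply: le_trans (up _ km) (Ik (ltnW km)).
have h1 : forall k, (k < m)%N -> l m.-1 <= l (m.-1 - k)%N.
  elim=> [|k Ik] km; first by rewrite subn0.
  apply: le_trans (Ik (ltnW km)) _.
  have -> : (m.-1 - k = (m.-1 - k.+1).+1)%N by lia.
  by apply: up; lia.
have := h1 (m.-1 - j)%N; have -> : (m.-1 - (m.-1 - j) = j)%N by lia.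
move=> h; apply/andP; split; first by apply: le_trans hl (h _); lia.
exact: le_trans (h0 _ jm) hr.
Qed.

End Vanishing.

(** * Plane waves *)

Section Exponential.
Variable R : realType.
Implicit Types x y t : R.

Lemma expi0 : expi 0 = 1 :> R[i].
Proof. by rewrite /expi cos0 sin0. Qed.

Lemma expiD x y : expi (x + y) = expi x * expi y.
Proof.
rewrite /expi cosD sinD; apply/eqP; rewrite eq_complex /=; apply/andP; split=> //.
by rewrite addrC (mulrC (sin x)).
Qed.

Lemma expi_neq0 x : expi x != 0.
Proof.
apply/negP => /eqP e; have := expiD x (- x).
by rewrite e mul0r subrr expi0 => /eqP; rewrite oner_eq0.
Qed.

Lemma expiN x : expi (- x) = (expi x)^-1.
Proof.
apply: (mulIf (expi_neq0 x)); rewrite mulVf ?expi_neq0//.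
by rewrite -expiD addNr expi0.
Qed.

Lemma expi_natmul x k : expi (x * k%:R) = expi x ^+ k.
Proof.
elim: k => [|k IH]; first by rewrite mulr0 expi0.
by rewrite -natr1 mulrDr mulr1 expiD IH exprSr.
Qed.

Lemma expi_intmul x (k : int) : expi (x * k%:~R) = expi x ^ k.
Proof.
case: k => k; first by rewrite -pmulrn expi_natmul.
by rewrite NegzE -exprz_inv mulrNz mulrN -mulNr -expiN -pmulrn expi_natmul.
Qed.

Lemma expi_2pi (k : int) : expi (2 * pi * k%:~R) = 1 :> R[i].
Proof.
rewrite expi_intmul /expi mulr_natl cos2pi sin2pi.
by have -> : (1 +i* 0)%C = 1 :> R[i] by []; rewrite exp1rz.
Qed.

Lemma expi_sum (I : finType) (f : I -> R) : expi (\sum_i f i) = \prod_i expi (f i).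
Proof. exact: (big_morph (@expi R) expiD expi0). Qed.

(** This turns phases into rational functions of e^(ix). The double-angle formulas make cos and sin
    of 2 atan t rational in t. *)
Lemma expi_vatan (a x : R) : -1 < a < 1 ->
  expi (vatan a x) * (1 - a%:C * expi x) = expi x - a%:C.
Proof.
move=> ha; set D := 1 - a * cos x.
have D0 : D != 0 by rewrite gt_eqF// poisson_den_gt0.
rewrite /vatan expiD -/D; set t := a * sin x / D.
have tp : 0 < 1 + t ^+ 2 by rewrite ltr_pwDl ?sqr_ge0.
have sq : Num.sqrt (1 + t ^+ 2) ^+ 2 = 1 + t ^+ 2 by rewrite sqr_sqrtr// ltW.
have ec : cos (atan t) ^+ 2 = (1 + t ^+ 2)^-1 by rewrite cos_atan exprVn sq.
have es : sin (atan t) = t * cos (atan t).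
  rewrite -{2}(atanK t) /tan divfK// cos_atan invr_neq0// gt_eqF// sqrtr_gt0//.
have c2 : cos (2 * atan t) = (1 - t ^+ 2) / (1 + t ^+ 2).
  by rewrite mulr_natl cos_mulr2n ec; field; rewrite gt_eqF.
have s2 : sin (2 * atan t) = 2 * t / (1 + t ^+ 2).
  by rewrite mulr_natl sin_mulr2n es mulrCA -expr2 ec; field; rewrite gt_eqF.
have tD : t * D = a * sin x by rewrite /t divfK.
have e := cos2Dsin2 x.
have t1 : 1 + t ^+ 2 != 0 by rewrite gt_eqF.
set C := cos (2 * atan t) in c2 *; set S := sin (2 * atan t) in s2 *.
(* [h1] and [h2] are the real and imaginary parts of (C + iS)(1 - it) = 1 + it. *)
have h1 : C + t * S = 1 by rewrite c2 s2; field.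
have h2 : S - t * C = t by rewrite c2 s2; field.
have e1 : D = 1 - a * cos x by [].
rewrite /expi -/C -/S; apply/eqP; rewrite eq_complex /= !mul0r !(subr0, addr0, sub0r).
rewrite -/D -tD; apply/andP; split; apply/eqP.
  transitivity (D * cos x * (C + t * S) - sin x * (D * (S - t * C))); first by ring.
  rewrite h1 h2 (mulrC D t) tD mulr1.
  transitivity (cos x - a * (cos x ^+ 2 + sin x ^+ 2)); first by rewrite /D; ring.
  by rewrite e mulr1.
transitivity (cos x * (D * (S - t * C)) + D * sin x * (C + t * S)); first by ring.
by rewrite h1 h2 (mulrC D t) tD mulr1 /D; ring.
Qed.

Lemma complex_eq_re_im (z w : R[i]) : complex.Re z = complex.Re w ->
  complex.Im z = complex.Im w -> z = w.
Proof. by case: z w => [a b] [c d] /= -> ->. Qed.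

Lemma expi_cos x : expi x + (expi x)^-1 = (2 * cos x)%:C.
Proof.
rewrite -expiN /expi sinN cosN; apply: complex_eq_re_im => /=; last exact: subrr.
by rewrite mulr_natl mulr2n.
Qed.

(** Regularity free of multiples of 2 pi, in the form in which it enters: the denominators of C do
    not vanish. *)
Definition exp_regular (m : nat) (y : 'I_m -> R) : Prop :=
  (forall j, expi (2 * y j) != 1) /\
  (forall j k, j != k -> expi (y j + y k) != 1 /\ expi (y j - y k) != 1).

End Exponential.

(** * The coefficient C under reflections *)

Section PlaneWaves.
Variables (R : realType) (m : nat) (q pp qp : R).
Implicit Types (y : 'I_m -> R) (l : nat -> int).
Let K := R[i].

Definition cfac (x : R) : K :=
  (1 - (pp + qp)%:C * expi (- x) + (pp * qp)%:C * expi (- (2 * x)))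
  / (1 - expi (- (2 * x))).

Definition afac (t : R) : K := (1 - q%:C * expi (- t)) / (1 - expi (- t)).

Definition gfac (x y : R) : K := afac (x - y) * afac (x + y).

Lemma CfunE y : Cfun q pp qp y =
  (\prod_(j < m) cfac (y j)) *
  \prod_(p : 'I_m * 'I_m | (p.1 < p.2)%N) gfac (y p.1) (y p.2).
Proof.
rewrite /Cfun; congr (_ * _); rewrite pair_big_dep /=.
by apply: eq_bigr => p _; rewrite /gfac mulf_div.
Qed.

Lemma gfacNr (x t : R) : gfac x (- t) = gfac x t.
Proof. by rewrite /gfac opprK mulrC. Qed.

Definition flip (i : 'I_m) y : 'I_m -> R := fun k => if k == i then - y k else y k.

(** A simple reflection permutes the positive roots other than its own, so all other factors go into
    the common [A]. *)
Lemma Cfun_swap y (j j' : 'I_m) : j' = j.+1 :> nat ->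
  exists A, Cfun q pp qp y = A * afac (y j - y j') /\
    Cfun q pp qp (y \o tperm j j') = A * afac (y j' - y j).
Proof.
move=> jj'; set tau := tperm j j'.
pose P (p : 'I_m * 'I_m) := (p.1 < p.2)%N && (p != (j, j')).
pose rest y := \prod_(p | P p) gfac (y p.1) (y p.2).
have CE y' : Cfun q pp qp y' = (\prod_k cfac (y' k)) * (gfac (y' j) (y' j') * rest y').
  by rewrite CfunE (bigD1 (j, j'))//= jj'.
have restE : rest (y \o tau) = rest y.
  have tauK : involutive (fun p : 'I_m * 'I_m => (tau p.1, tau p.2)).
    by move=> [a b] /=; rewrite !tpermK.
  rewrite /rest (reindex_inj (inv_inj tauK)) /=.
  apply: eq_big => [[a b]|[a b] _]; last by rewrite /= !tpermK.
  rewrite /P /= !xpair_eqE /tau.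
  by case: tpermP => [->|->|/eqP + /eqP +]; case: tpermP => [->|->|/eqP + /eqP +];
    rewrite -?val_eqE /= ?jj'; lia.
exists ((\prod_k cfac (y k)) * afac (y j + y j') * rest y); split.
  by rewrite CE /gfac; ring.
rewrite CE restE /= tpermL tpermR [\prod_k _](reindex_inj (@perm_inj _ tau)) /=.
rewrite (eq_bigr (fun k => cfac (y k))); last by move=> k _; rewrite /tau tpermK.
by rewrite /gfac (addrC (y j') (y j)); ring.
Qed.

Lemma Cfun_flip_last y (i : 'I_m) : i = m.-1 :> nat ->
  exists A, Cfun q pp qp y = A * cfac (y i) /\
    Cfun q pp qp (flip i y) = A * cfac (- y i).
Proof.
move=> im; exists ((\prod_(k | k != i) cfac (y k)) *
   \prod_(p : 'I_m * 'I_m | (p.1 < p.2)%N) gfac (y p.1) (y p.2)).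
rewrite !CfunE !(bigD1 i (P := xpredT))//= /flip eqxx; split; first by ring.
rewrite (eq_bigr (fun k => cfac (y k))); last by move=> k /negbTE ->.
rewrite [X in _ * X = _](eq_bigr (fun p => gfac (y p.1) (y p.2))); first by ring.
move=> [a b] /= ab; have -> : (a == i) = false.
  by apply/negbTE; rewrite -val_eqE /= im; have := ltn_ord b; lia.
by case: eqP => // _; rewrite gfacNr.
Qed.

(** The sign change of the first coordinate is the linear part of the affine reflection. Unlike a
    simple one, it affects every factor containing that coordinate; their ratios add up to the
    phases of the Bethe equation. *)
Lemma Cfun_flip_first y (i : 'I_m) : i = 0%N :> nat ->
  exists A, Cfun q pp qp y = A * (cfac (y i) * \prod_(k | k != i) gfac (y i) (y k)) /\
    Cfun q pp qp (flip i y) = A * (cfac (- y i) * \prod_(k | k != i) gfac (- y i) (y k)).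
Proof.
move=> i0; pose P (p : 'I_m * 'I_m) := (p.1 < p.2)%N && (p.1 != i).
pose rest y := \prod_(p | P p) gfac (y p.1) (y p.2).
have CE y' : Cfun q pp qp y' = (\prod_(k | k != i) cfac (y' k)) * rest y' *
    (cfac (y' i) * \prod_(k | k != i) gfac (y' i) (y' k)).
  have E : \prod_(p : 'I_m * 'I_m | (p.1 < p.2)%N && (p.1 == i)) gfac (y' p.1) (y' p.2)
      = \prod_(k | k != i) gfac (y' i) (y' k).
    rewrite (reindex_onto (fun k => (i, k)) snd) /=; last first.
      by move=> [a b] /= /andP[_ /eqP ->].
    by apply: eq_bigl => k; rewrite !eqxx !andbT -val_eqE /= i0; lia.
  rewrite CfunE (bigD1 i)//= (bigID (fun p : 'I_m * 'I_m => p.1 == i))/= -/(rest y') E.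
  ring.
exists ((\prod_(k | k != i) cfac (y k)) * rest y); split; first exact: CE.
rewrite CE; congr (_ * _ * (_ * _)).
- by apply: eq_bigr => k /negbTE ki; rewrite /flip ki.
- apply: eq_bigr => [[a b]] /andP[/= ab /negbTE ai]; rewrite /flip ai.
  by rewrite -val_eqE /= i0; case: eqP => //= b0; rewrite b0 in ab.
- by rewrite /flip eqxx.
- by apply: eq_bigr => k /negbTE ki; rewrite /flip ki eqxx.
Qed.

End PlaneWaves.

(** Doubling the sum and reindexing one copy by [t] avoids choosing a representative in each
    pair. *)
Lemma sum_antisym (K : numDomainType) (I : finType) (t : I -> I) (f : I -> K) :
  involutive t -> (forall i, f i + f (t i) = 0) -> \sum_i f i = 0.
Proof.
move=> tK ft; apply/eqP; rewrite -[_ == 0]/(false || _) -(mulrn_eq0 _ 2).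
rewrite mulr2n {2}(reindex_inj (inv_inj tK)) -big_split /=.
by apply/eqP; apply: big1 => i _; exact: ft.
Qed.

Section PlaneWaveMonomials.
Variables (R : realType) (m : nat).
Implicit Types (y : 'I_m -> R) (l : nat -> int) (a b : int).
Let K := R[i].

Definition wmon y l : K := \prod_(k < m) expi (y k) ^ l k.

Lemma wmon_upd y l (j : 'I_m) a :
  wmon y (upd l j a) = expi (y j) ^ a * \prod_(k < m | k != j) expi (y k) ^ l k.
Proof.
rewrite /wmon (bigD1 j)//= {1}/upd eqxx; congr (_ * _).
by apply: eq_bigr => k kj; rewrite /upd val_eqE (negbTE kj).
Qed.

Lemma wmon_upd2 y l (j j' : 'I_m) a b : j' = j.+1 :> nat ->
  wmon y (upd2 l j a b) = expi (y j) ^ a * expi (y j') ^ b *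
    \prod_(k < m | (k != j) && (k != j')) expi (y k) ^ l k.
Proof.
move=> jj'; have j'j : j' != j by rewrite -val_eqE /= jj' gtn_eqF.
rewrite /upd2 wmon_upd (bigD1 j')//= -mulrA; congr (_ * (_ * _)).
  by rewrite /upd -jj' eqxx.
by apply: eq_bigr => k /andP[_ kj]; rewrite /upd -jj' val_eqE (negbTE kj).
Qed.

Lemma wmon_upd2_swap y l (j j' : 'I_m) a b : j' = j.+1 :> nat ->
  wmon (y \o tperm j j') (upd2 l j a b) = expi (y j') ^ a * expi (y j) ^ b *
    \prod_(k < m | (k != j) && (k != j')) expi (y k) ^ l k.
Proof.
move=> jj'; rewrite (wmon_upd2 _ _ _ _ jj').
apply: (congr2 *%R); first by rewrite /= tpermL tpermR.
by apply: eq_bigr => k /andP[kj kj'] /=; rewrite tpermD// eq_sym.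
Qed.

Lemma wmon_shift y l (j : 'I_m) a :
  wmon y (upd l j (l j + a)) = expi (y j) ^ a * wmon y l.
Proof.
rewrite wmon_upd expfzDr ?expi_neq0// [in RHS]/wmon [in RHS](bigD1 j)//= mulrA.
by rewrite (mulrC (_ ^ a)).
Qed.

End PlaneWaveMonomials.

(** * The wave function on Z^m and its relations *)

Section WaveFunction.
Variables (R : realType) (m : nat) (q pp qp : R) (xi : 'rV[R]_m).
Implicit Types (l : nat -> int) (a b : int).
Let K := R[i].
Let W := ('S_m * {ffun 'I_m -> bool})%type.

Definition orb (w : W) : 'I_m -> R :=
  fun j => (if w.2 j then -1 else 1) * xi ord0 (w.1 j).

Definition swapW (j j' : 'I_m) (w : W) : W :=
  ((tperm j j' * w.1)%g, [ffun k => w.2 (tperm j j' k)]).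

Definition flipW (i : 'I_m) (w : W) : W := (w.1, [ffun k => (k == i) (+) w.2 k]).

Lemma swapWK j j' : involutive (swapW j j').
Proof.
move=> [s e]; rewrite /swapW /=; congr (_, _); first by rewrite mulgA tperm2 mul1g.
by apply/ffunP => k; rewrite !ffunE tpermK.
Qed.

Lemma flipWK i : involutive (flipW i).
Proof.
move=> [s e]; rewrite /flipW /=; congr (_, _).
by apply/ffunP => k; rewrite !ffunE addKb.
Qed.

Lemma orb_swap j j' w : orb (swapW j j' w) = orb w \o tperm j j'.
Proof. by apply/funext => k; rewrite /orb /= ffunE permM. Qed.

Lemma orb_flip i w : orb (flipW i w) = flip i (orb w).
Proof.
apply/funext => k; rewrite /orb /flip /= ffunE; case: eqP => //= _.
by case: (w.2 k); rewrite /= !(mulN1r, mul1r, opprK).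
Qed.

Definition wave (l : nat -> int) : K :=
  \sum_(w : W) Cfun q pp qp (orb w) * wmon (orb w) l.

Lemma Rreg_wave (lam : seq nat) :
  Rreg q pp qp lam xi = wave (fun j => (nth 0%N lam j)%:Z).
Proof.
rewrite /Rreg pair_big; apply: eq_bigr => -[s e] _ /=; congr (_ * _).
by rewrite expi_sum; apply: eq_bigr => k _; rewrite -expi_intmul.
Qed.

(** Each plane wave is an eigenfunction of the free Laplacian, and its eigenvalue is unchanged by
    permutations and signs, cosine being even. *)
Lemma wave_laplace l :
  \sum_(j < m) (wave (upd l j (l j + 1)) + wave (upd l j (l j - 1)))
  = (2 * \sum_(j < m) cos (xi ord0 j))%:C * wave l.
Proof.
rewrite /wave mulr_sumr.
under eq_bigr do rewrite -big_split.
rewrite exchange_big /=; apply: eq_bigr => w _.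
under eq_bigr do rewrite !wmon_shift -mulrDr -mulrDl.
rewrite -mulr_sumr -mulr_suml [in RHS]mulrCA; congr (_ * (_ * _)).
rewrite (eq_bigr (fun j => (2 * cos (orb w j))%:C)); last first.
  by move=> j _; rewrite expr1z exprN1 expi_cos.
rewrite -rmorph_sum -mulr_sumr; apply: (congr1 (fun t => (2 * t)%:C)).
rewrite [RHS](reindex_inj (@perm_inj _ w.1)) /=; apply: eq_bigr => j _.
by rewrite /orb; case: (w.2 j); rewrite ?mul1r// mulN1r cosN.
Qed.

Hypothesis xi_reg : exp_regular (xi ord0).

Lemma orb_regular w : exp_regular (orb w).
Proof.
have inv t : expi t != 1 -> expi (- t) != 1 :> R[i].
  by rewrite expiN invr_eq1.
have [r1 r2] := xi_reg; split=> [j|j k jk]; rewrite /orb.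
  case: (w.2 j); rewrite ?mul1r ?r1// mulN1r mulrN inv// r1.
have sjk : w.1 j != w.1 k by rewrite (inj_eq perm_inj).
have [p1 p2] := r2 _ _ sjk; have := inv _ p1; have := inv _ p2.
rewrite opprB opprD.
by case: (w.2 j); case: (w.2 k); rewrite ?mul1r ?mulN1r ?opprK => p3 p4; split=> //;
  rewrite addrC.
Qed.

Lemma afac_neq (t : R) : expi t != 1 :> R[i] ->
  afac q t = (expi t - q%:C) / (expi t - 1) /\
  afac q (- t) = (1 - q%:C * expi t) / (1 - expi t).
Proof.
move=> t1; rewrite /afac opprK expiN; split=> //.
have z0 := expi_neq0 t.
by field; rewrite z0 subr_eq0 t1.
Qed.

(** Let z1, z2 be the exponentials of the two coordinates. The relation turns a plane wave into (1 -
    q z1/z2) S, and [afac] contributes (1 - q z2/z1)/(1 - z2/z1). The two numerators have a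
    symmetric product, and exchanging z1 and z2 multiplies S by z1/z2, which makes S/(1 - z2/z1)
    change sign. *)
Lemma wave_rel_swap : rel_swap m q%:C wave.
Proof.
move=> l j0 a b jm.
pose j := Ordinal (ltnW jm); pose j' := Ordinal jm.
have jj' : j' = j.+1 :> nat by [].
have j'j : j != j' by rewrite -val_eqE /= ltn_eqF.
rewrite /wave !mulr_sumr -!(sumrN, big_split) /=.
apply: (sum_antisym (swapWK j j')) => w.
rewrite -[j0]/(nat_of_ord j) !orb_swap !(wmon_upd2_swap _ _ _ _ jj')
  !(wmon_upd2 _ _ _ _ jj').
have [A [-> ->]] := Cfun_swap q pp qp (orb w) jj'.
have [_ r] := orb_regular w; have [_ r12] := r _ _ j'j.
move: (\prod_(k < m | _) _) => P.
have [-> _] := afac_neq r12; rewrite -(opprB (orb w j')); rewrite opprB.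
have [_] := afac_neq r12; rewrite opprB => ->.
move: r12; rewrite expiD expiN.
have := expi_neq0 (orb w j); have := expi_neq0 (orb w j').
move: (expi (orb w j)) (expi (orb w j')) => z1 z2 z20 z10 z12.
rewrite !expfzDr// !expr1z !exprN1.
move: (z1 ^ a) (z1 ^ b) (z2 ^ a) (z2 ^ b) => u s t v.
have z1z2 : z1 - z2 != 0.
  by rewrite subr_eq0; apply: contraNneq z12 => ->; rewrite divff.
by field; rewrite z10 z20 -[z2 - z1]opprB oppr_eq0 mulN1r z1z2.
Qed.

Lemma wmon_flip y l (i : 'I_m) (a : int) :
  wmon (flip i y) (upd l i a) =
  expi (y i) ^ (- a) * \prod_(k < m | k != i) expi (y k) ^ l k :> K.
Proof.
rewrite wmon_upd; apply: (congr2 *%R).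
  have -> : flip i y i = - y i by rewrite /flip eqxx.
  by rewrite expiN exprz_inv.
by apply: eq_bigr => k /negbTE ki; rewrite /flip ki.
Qed.

Lemma cfac_eq (x : R) : expi (2 * x) != 1 :> K -> let z := expi x in
  [/\ z ^+ 2 != 1, cfac pp qp x = (z - pp%:C) * (z - qp%:C) / (z ^+ 2 - 1) &
   cfac pp qp (- x) = (1 - pp%:C * z) * (1 - qp%:C * z) / (1 - z ^+ 2)].
Proof.
have dbl : expi (2 * x) = expi x ^+ 2 :> K by rewrite mulrC expi_natmul.
rewrite dbl /= => z1; split=> //.
  rewrite /cfac !expiN dbl.
  by have z0 := expi_neq0 x; rewrite rmorphD rmorphM; field; rewrite z0 subr_eq0 z1.
rewrite /cfac opprK mulrN opprK dbl.
by rewrite rmorphD rmorphM; field; rewrite subr_eq0 eq_sym z1.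
Qed.

(** The relation multiplies a plane wave by (1 - pp z)(1 - qp z)/z, apart from the even factor z^k +
    z^(-k). Together with the numerator of [cfac] this is even under z -> 1/z up to 1/(z - 1/z),
    which is odd. *)
Lemma wave_rel_left : rel_left m (pp * qp)%:C (pp + qp)%:C wave.
Proof.
move=> l k m0 /=; have [i iE] : exists i : 'I_m, i = m.-1 :> nat.
  by have im : (m.-1 < m)%N by [rewrite prednK]; exists (Ordinal im).
have E x : upd l m.-1 x = upd l i x by rewrite iE.
rewrite !E /wave !mulr_sumr -!(sumrN, big_split) /=.
apply: (sum_antisym (flipWK i)) => w.
rewrite !orb_flip !wmon_flip !wmon_upd.
have [A [-> ->]] := Cfun_flip_last q pp qp (orb w) iE.
have [r _] := orb_regular w; have [z1 -> ->] := cfac_eq (r i).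
move: (\prod_(k < m | _) _) => P.
have := expi_neq0 (orb w i); move: (expi (orb w i)) z1 => z z1 z0.
rewrite !(opprD, opprK) !expfzDr// !expr1z !exprN1 -!invr_expz.
have := expfz_neq0 k z0; move: (z ^ k) => u u0.
rewrite rmorphD rmorphM; field.
by rewrite z0 u0 !subr_eq0 z1 eq_sym z1.
Qed.

Section BetheEquations.
Variables (n : nat) (pm qm : R).
Hypotheses (hq : -1 < q < 1) (hpp : -1 < pp < 1) (hqp : -1 < qp < 1)
  (hpm : -1 < pm < 1) (hqm : -1 < qm < 1).

Lemma afac_reflect (t : R) : expi t != 1 :> K ->
  afac q t = - expi (vatan q t) * afac q (- t).
Proof.
move=> t1; have [-> ->] := afac_neq t1; rewrite -(expi_vatan t hq).
by field; rewrite -[1 - expi t]opprB oppr_eq0 !subr_eq0 t1.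
Qed.

Lemma gfac_reflect (x t : R) : expi (x + t) != 1 :> K -> expi (x - t) != 1 :> K ->
  gfac q x t = expi (qphase q x t) * gfac q (- x) t.
Proof.
move=> h1 h2; rewrite /gfac /qphase afac_reflect// (afac_reflect h1) expiD.
by rewrite opprD [- x + t]addrC -(opprB x t) (addrC (- x)) !opprB !opprD ?opprK; ring.
Qed.

(** The phases of [pp] and [qp] come from [cfac], those of [pm] and [qm] from the right boundary
    operator, which factors as (z - pm)(z - qm)/z. *)
Lemma cfac_reflect (x : R) : expi (2 * x) != 1 :> K -> let z := expi x in
  cfac pp qp x * (z - (pm + qm)%:C + (pm * qm)%:C / z) =
  - expi (bphase pp qp pm qm x) * cfac pp qp (- x) *
    (z^-1 - (pm + qm)%:C + (pm * qm)%:C * z).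
Proof.
move=> x2 /=; have z0 := expi_neq0 x; have [z1 -> ->] := cfac_eq x2.
rewrite /bphase 3!expiD.
have := expi_vatan x hpp; have := expi_vatan x hqp.
have := expi_vatan x hpm; have := expi_vatan x hqm.
move: (expi x) z0 z1 => z z0 z1 vqm vpm vqp vpp.
have -> : z - (pm + qm)%:C + (pm * qm)%:C / z = (z - pm%:C) * (z - qm%:C) / z.
  by rewrite rmorphD rmorphM; field.
have -> : z^-1 - (pm + qm)%:C + (pm * qm)%:C * z =
    (1 - pm%:C * z) * (1 - qm%:C * z) / z.
  by rewrite rmorphD rmorphM; field.
rewrite -vpp -vqp -vpm -vqm.
by field; rewrite z0 -[1 - z ^+ 2]opprB oppr_eq0 !subr_eq0 z1.
Qed.

Hypothesis bethe : forall j : 'I_m, expi (bethe_phase n q pp qp pm qm xi j) = 1 :> K.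

(** The Bethe equations are invariant under signed permutations: [qphase] is even in its second
    argument, and the whole phase is odd in its first, so a sign only inverts the exponential. *)
Lemma orb_bethe w (i : 'I_m) :
  expi (\sum_(k < m | k != i) qphase q (orb w i) (orb w k)
    + 2 * n%:R * orb w i + bphase pp qp pm qm (orb w i)) = 1 :> K.
Proof.
have qphaseNr (x t : R) : qphase q x (- t) = qphase q x t.
  by rewrite /qphase opprK addrC.
have qphaseNl (x t : R) : qphase q (- x) t = - qphase q x t.
  have -> : qphase q (- x) t = vatan q (- (x - t)) + vatan q (- (x + t)).
    by rewrite /qphase opprB opprD (addrC t).
  by rewrite !vatanN /qphase; ring.
have bphaseN (x : R) : bphase pp qp pm qm (- x) = - bphase pp qp pm qm x.
  by rewrite /bphase !vatanN !opprD.
have E : \sum_(k < m | k != i) qphase q (orb w i) (orb w k) =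
    \sum_(l < m | l != w.1 i) qphase q (orb w i) (xi ord0 l).
  rewrite [RHS](reindex_inj (@perm_inj _ w.1)) /=.
  apply: eq_big => k; first by rewrite (inj_eq perm_inj).
  move=> _; rewrite [X in qphase q _ X = _]/orb.
  by case: (w.2 k); rewrite ?mul1r ?mulN1r ?qphaseNr.
have := bethe (w.1 i); rewrite E /bethe_phase /orb; case: (w.2 i); last by rewrite mul1r.
rewrite mulN1r bphaseN mulrN [X in _ -> expi (X + _ + _) = _]
  (eq_bigr (fun j => - qphase q (xi ord0 (w.1 i)) (xi ord0 j))).
  by rewrite sumrN -!opprD expiN => ->; rewrite invr1.
by move=> j _; rewrite qphaseNl.
Qed.

Lemma wave_rel_right : rel_right m n (pm * qm)%:C (pm + qm)%:C wave.
Proof.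
move=> l k m0 /=; have [i iE] : exists i : 'I_m, i = 0%N :> nat by exists (Ordinal m0).
have E x : upd l 0%N x = upd l i x by rewrite iE.
rewrite !E /wave !mulr_sumr -!(sumrN, big_split) /=.
apply: (sum_antisym (flipWK i)) => w.
rewrite !orb_flip !wmon_flip !wmon_upd.
have [A [-> ->]] := Cfun_flip_first q pp qp (orb w) iE.
have [r r2] := orb_regular w.
have -> : \prod_(k < m | k != i) gfac q (orb w i) (orb w k) =
    expi (\sum_(k < m | k != i) qphase q (orb w i) (orb w k)) *
    \prod_(k < m | k != i) gfac q (- orb w i) (orb w k).
  rewrite (big_morph (@expi R) (@expiD R) (@expi0 R)) -big_split /=.
  apply: eq_bigr => j; rewrite eq_sym => ij; have [h1 h2] := r2 _ _ ij.
  exact: gfac_reflect.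
have := cfac_reflect (r i); have := orb_bethe w i.
rewrite 2!expiD (_ : 2 * n%:R * orb w i = orb w i * (2 * n)%:R); last by rewrite natrM; ring.
rewrite expi_natmul mulnC exprM.
move: (\prod_(k < m | k != i) gfac q (- orb w i) (orb w k)) => G.
move: (\prod_(k < m | k != i) expi (orb w k) ^ l k) => P.
move: (expi (\sum_(k < m | k != i) qphase q (orb w i) (orb w k))) => e1.
move: (expi (bphase pp qp pm qm (orb w i))) => e2.
have := expi_neq0 (orb w i).
move: (cfac pp qp (orb w i)) (cfac pp qp (- orb w i)) => c1 c2.
move: (expi (orb w i)) => z z0 eB eC.
rewrite !(opprD, opprK) !expfzDr// !expr1z !exprN1 -!invr_expz -!exprnP.
have zn0 := expf_neq0 n z0; have zk0 := expfz_neq0 k z0.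
move: (z ^+ n) (z ^ k) zn0 zk0 eB => u v u0 v0 eB.
(* The Bethe equation with z^(2n) divided evenly, as the relation is centred at n: u is z^n. *)
have eE : e1 * u * e2 = u^-1.
  by apply: (mulIf u0); rewrite mulVf// -[RHS]eB; ring.
transitivity (A * P * G * (v + v^-1) * (e1 * u * (c1 * (z - (pm + qm)%:C + (pm * qm)%:C / z))
    + u^-1 * (c2 * (z^-1 - (pm + qm)%:C + (pm * qm)%:C * z)))).
  by field; rewrite z0 u0 v0.
rewrite eC -eE; ring.
Qed.

End BetheEquations.

End WaveFunction.

(** * Regularity of the Bethe vectors *)

Section Regularity.
Variables (R : realType) (m : nat).
Implicit Types x : 'rV[R]_m.

Lemma expi_inj_re_im (s t : R) : expi s = expi t -> cos s = cos t /\ sin s = sin t.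
Proof. by case. Qed.

Definition ordered_angles x : Prop :=
  (forall j, 0 < x ord0 j < pi) /\
  (forall j k : 'I_m, (j < k)%N -> x ord0 k < x ord0 j).

Lemma ordered_angles_inj x : ordered_angles x -> injective (x ord0).
Proof.
move=> [_ d] j k e; have [jk|kj|jk] := ltngtP j k.
- by have := d _ _ jk; rewrite -e ltxx.
- by have := d _ _ kj; rewrite -e ltxx.
- exact: val_inj.
Qed.

Lemma cos_ordered_inj (s t : R) : 0 < s < pi -> 0 < t < pi -> cos s = cos t -> s = t.
Proof.
move=> /andP[s0 s1] /andP[t0 t1]; apply: cos_inj; rewrite in_itv /= ?ltW//.
Qed.

Lemma expi_eq1 (s t : R) : expi (s + t) = 1 -> cos s = cos t /\ sin s = - sin t.
Proof.
move=> e; have : expi s = expi (- t).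
  by apply: (mulIf (expi_neq0 t)); rewrite -!expiD addNr expi0.
by move=> /expi_inj_re_im; rewrite cosN sinN.
Qed.

(** On ]0, pi[ the sine is positive, which excludes e^(2i x_j) = 1, and the cosine is injective,
    which excludes both e^(i(x_j + x_k)) = 1 and e^(i(x_j - x_k)) = 1. *)
Lemma ordered_exp_regular x : ordered_angles x -> exp_regular (x ord0).
Proof.
move=> ox; have [r _] := ox; split=> [j|j k jk].
  apply/eqP; rewrite mulr_natl mulr2n => /expi_eq1[_ e].
  by have := sin_gt0_pi (r j); lra.
split; apply/eqP => /expi_eq1[]; rewrite ?cosN => e _;
  by move/eqP: jk; apply; apply: (ordered_angles_inj ox); exact: cos_ordered_inj e.
Qed.

Lemma exp_regular_regular x : exp_regular (x ord0) -> regular x.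
Proof.
move=> [r1 r2]; split=> [j l|j k jk l].
  by apply/eqP => e; have := r1 j; rewrite e expi_2pi eqxx.
have [h1 h2] := r2 _ _ jk.
by split; apply/eqP => e; [move: h1|move: h2]; rewrite e expi_2pi eqxx.
Qed.

End Regularity.

(* R[i] is handled as the plane R x R, through its real and imaginary parts. *)
Section ComplexContinuity.
Variables (R : realType) (T : topologicalType) (x : T).
Implicit Types (f g : T -> R[i]) (h : T -> R).

Definition ccont f : Prop :=
  {for x, continuous (fun y => complex.Re (f y))} /\
  {for x, continuous (fun y => complex.Im (f y))}.

Lemma ccont_ext f g : (forall y, f y = g y) -> ccont f -> ccont g.
Proof. by move=> /funext ->. Qed.

Lemma ccont_cst (c : R[i]) : ccont (fun=> c).
Proof. by split; exact: cst_continuous. Qed.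

Lemma ccontD f g : ccont f -> ccont g -> ccont (fun y => f y + g y).
Proof.
move=> [f1 f2] [g1 g2]; split.
  have -> : (fun y => complex.Re (f y + g y)) =
    (fun y => complex.Re (f y) + complex.Re (g y)).
    by apply/funext => y; case: (f y) (g y) => [a b] [c d].
  exact: continuousD.
have -> : (fun y => complex.Im (f y + g y)) =
  (fun y => complex.Im (f y) + complex.Im (g y)).
  by apply/funext => y; case: (f y) (g y) => [a b] [c d].
exact: continuousD.
Qed.

Lemma ccontN f : ccont f -> ccont (fun y => - f y).
Proof.
move=> [f1 f2]; split.
  have -> : (fun y => complex.Re (- f y)) = (fun y => - complex.Re (f y)).
    by apply/funext => y; case: (f y).
  exact: continuousN.
have -> : (fun y => complex.Im (- f y)) = (fun y => - complex.Im (f y)).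
  by apply/funext => y; case: (f y).
exact: continuousN.
Qed.

Lemma ccontM f g : ccont f -> ccont g -> ccont (fun y => f y * g y).
Proof.
move=> [f1 f2] [g1 g2]; split.
  have -> : (fun y => complex.Re (f y * g y)) =
    (fun y => complex.Re (f y) * complex.Re (g y) - complex.Im (f y) * complex.Im (g y)).
    by apply/funext => y; case: (f y) (g y) => [a b] [c d].
  by apply: continuousB; exact: continuousM.
have -> : (fun y => complex.Im (f y * g y)) =
  (fun y => complex.Re (f y) * complex.Im (g y) + complex.Im (f y) * complex.Re (g y)).
  by apply/funext => y; case: (f y) (g y) => [a b] [c d].
by apply: continuousD; exact: continuousM.
Qed.

Lemma ccontV f : f x != 0 -> ccont f -> ccont (fun y => (f y)^-1).
Proof.
move=> fx0 [f1 f2].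
pose N y := complex.Re (f y) * complex.Re (f y) + complex.Im (f y) * complex.Im (f y).
have N0 : N x != 0.
  apply: contra fx0; rewrite /N -!expr2 paddr_eq0 ?sqr_ge0// !sqrf_eq0 => /andP[a0 b0].
  by rewrite eq_complex a0 b0.
have cN : {for x, continuous (fun y => (N y)^-1)}.
  apply: continuousV => //; rewrite /N.
  by apply: continuousD; exact: continuousM.
split.
  have -> : (fun y => complex.Re (f y)^-1) = (fun y => complex.Re (f y) * (N y)^-1).
    by apply/funext => y; rewrite /N; case: (f y).
  exact: continuousM.
have -> : (fun y => complex.Im (f y)^-1) = (fun y => (- complex.Im (f y)) * (N y)^-1).
  by apply/funext => y; rewrite /N; case: (f y) => a b /=; rewrite mulNr.
by apply: continuousM => //; exact: continuousN.
Qed.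

Lemma ccont_expi h : {for x, continuous h} -> ccont (fun y => expi (h y)).
Proof.
by move=> hx; split; apply: continuous_comp => //;
  [exact: continuous_cos|exact: continuous_sin].
Qed.

Lemma ccont_big (op : R[i] -> R[i] -> R[i]) (e : R[i]) (I : finType) (P : pred I)
    (F : I -> T -> R[i]) :
  (forall f g, ccont f -> ccont g -> ccont (fun y => op (f y) (g y))) ->
  (forall i, P i -> ccont (F i)) -> ccont (fun y => \big[op/e]_(i | P i) F i y).
Proof.
move=> Hop H; elim: (index_enum I) => [|i s IH].
  by apply: ccont_ext (ccont_cst e) => y; rewrite big_nil.
have [Pi|nPi] := boolP (P i).
  apply: ccont_ext (Hop _ _ (H i Pi) IH) => y; by rewrite big_cons Pi.
by apply: ccont_ext IH => y; rewrite big_cons (negbTE nPi).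
Qed.

End ComplexContinuity.

(** * The extended polynomial at regular points *)

Section Extension.
Variables (R : realType) (m : nat) (q pp qp : R).

Lemma Rreg_ccont (lam : seq nat) (xi : 'rV[R]_m) : exp_regular (xi ord0) ->
  ccont xi (Rreg q pp qp lam).
Proof.
move=> rx; apply: ccont_big => [|s _]; first exact: ccontD.
apply: ccont_big => [|e _]; first exact: ccontD.
pose y (x : 'rV[R]_m) (j : 'I_m) : R := (if e j then -1 else 1) * x ord0 (s j).
have cy j : {for xi, continuous (y^~ j)}.
  by apply: continuousM; [exact: cst_continuous|exact: coord_continuous].
have [r1 r2] : exp_regular (y xi) := orb_regular rx (s, e).
have d0 (t : R) : expi t != 1 -> 1 - expi (- t) != 0.
  by move=> t1; rewrite subr_eq0 eq_sym expiN invr_eq1.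
have c2 j : {for xi, continuous (fun x => - (2 * y x j))}.
  by apply: continuousN; apply: continuousM => //; exact: cst_continuous.
apply: ccontM; last first.
  apply: (@ccont_ext _ _ _ (fun x => \prod_j expi (y x j * (nth 0%N lam j)%:R))).
    by move=> x; rewrite expi_sum.
  apply: ccont_big => [|j _]; first exact: ccontM.
  by apply: ccont_expi; apply: continuousM => //; exact: cst_continuous.
apply: ccontM; (apply: ccont_big => [|j _]; first exact: ccontM).
  apply: ccontM.
    apply: ccontD; last by apply: ccontM; [exact: ccont_cst|exact: ccont_expi (c2 j)].
    apply: ccontD; first exact: ccont_cst.
    apply: ccontN; apply: ccontM; first exact: ccont_cst.
    exact: ccont_expi (continuousN (cy j)).
  apply: ccontV; first exact: d0 (r1 j).
  by apply: ccontD; [exact: ccont_cst|exact: ccontN (ccont_expi (c2 j))].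
apply: ccont_big => [|k jk]; first exact: ccontM.
have jnk : j != k by rewrite -val_eqE /= ltn_eqF.
have [h1 h2] := r2 _ _ jnk.
have cB : ccont xi (fun x => expi (- (y x j - y x k))).
  exact: ccont_expi (continuousN (continuousB (cy j) (cy k))).
have cD : ccont xi (fun x => expi (- (y x j + y x k))).
  exact: ccont_expi (continuousN (continuousD (cy j) (cy k))).
have c1 f : ccont xi f -> ccont xi (fun x => 1 - f x).
  by move=> cf; apply: ccontD; [exact: ccont_cst|exact: ccontN].
apply: ccontM.
  apply: ccontM; apply: c1; apply: ccontM; [exact: ccont_cst|exact: cB|
    exact: ccont_cst|exact: cD].
apply: ccontV; first exact: mulf_neq0 (d0 _ h2) (d0 _ h1).
by apply: ccontM; [exact: c1 cB|exact: c1 cD].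
Qed.

(** The explicit sum is continuous at [xi], so its limit through regular points is its value; the
    restricted filter is proper since [xi] is itself regular. *)
Lemma Rfun_regular (lam : seq nat) (xi : 'rV[R]_m) : exp_regular (xi ord0) ->
  Rfun q pp qp lam xi = Rreg q pp qp lam xi.
Proof.
move=> rx; have [cre cim] := Rreg_ccont lam rx.
have pf : ProperFilter (within (@regular R m) (nbhs xi)).
  apply: within_nbhs_proper; exact/subset_closure/exp_regular_regular.
rewrite /Rfun; case E : (Rreg q pp qp lam xi) => [a b]; congr (_ +i* _).
  apply: cvg_lim => //; rewrite -[a]/(complex.Re (a +i* b)) -E.
  by apply: cvg_trans cre; apply: cvg_app; exact: cvg_within.
apply: cvg_lim => //; rewrite -[b]/(complex.Im (a +i* b)) -E.
by apply: cvg_trans cim; apply: cvg_app; exact: cvg_within.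
Qed.

End Extension.

(** Interpolation: the functions f for which d f still satisfies all the relations are stable under
    multiplication by [z s j - c]. One such factor for each point other than [t] gives an f
    supported at [t]. *)
Lemma exponentials_free (K : fieldType) (m : nat) (T : finType)
    (z : T -> 'I_m -> K) (d : T -> K) :
  (forall t t', (forall j, z t j = z t' j) -> t = t') ->
  (forall l : 'I_m -> nat, \sum_t d t * \prod_j z t j ^+ l j = 0) ->
  forall t, d t = 0.
Proof.
move=> zinj H t.
pose good (f : T -> K) := forall l : 'I_m -> nat,
  \sum_s d s * f s * \prod_j z s j ^+ l j = 0.
have good1 : good (fun=> 1) by move=> l; under eq_bigr do rewrite mulr1; exact: H.
(* Multiplication by [z s j] is absorbed into the exponent vector, which is arbitrary. *)
have goodM f (j : 'I_m) c : good f -> good (fun s => f s * (z s j - c)).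
  move=> gf l; pose l' k := (l k + (k == j))%N.
  transitivity (\sum_s d s * f s * \prod_k z s k ^+ l' k
     - c * \sum_s d s * f s * \prod_k z s k ^+ l k).
    rewrite mulr_sumr -sumrB; apply: eq_bigr => s _.
    have -> : \prod_k z s k ^+ l' k = z s j * \prod_k z s k ^+ l k.
      rewrite (bigD1 j)//= [in RHS](bigD1 j)//= mulrA /l' eqxx addn1 exprS.
      by congr (_ * _); apply: eq_bigr => k /negbTE ->; rewrite addn0.
    by ring.
  by rewrite !gf mulr0 subr0.
have sep s : s != t -> exists j, z s j != z t j.
  move=> st; apply: contrapT => h; move/eqP: st; apply; apply: zinj => j.
  by apply: contrapT => zj; apply: h; exists j; exact/eqP.
have [f [gf ft fs]] : exists f, [/\ good f, f t != 0 & forall s, s != t -> f s = 0].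
  suff [f [gf ft fs]] : exists f, [/\ good f, f t != 0 &
      forall s, s \in enum T -> s != t -> f s = 0].
    by exists f; split=> // s st; apply: fs => //; rewrite mem_enum.
  elim: (enum T) => [|s0 r [f [gf ft fs]]].
    by exists (fun=> 1); split=> //; exact: oner_neq0.
  have [e|st] := eqVneq s0 t.
    exists f; split=> // s; rewrite inE e => /predU1P[->|]; first by rewrite eqxx.
    exact: fs.
  have [j zj] := sep _ st.
  exists (fun s => f s * (z s j - z s0 j)); split; first exact: goodM.
    by rewrite mulf_neq0// subr_eq0 eq_sym.
  move=> s; rewrite inE => /predU1P[->|sr] h; first by rewrite subrr mulr0.
  by rewrite fs// mul0r.
have S0 : \sum_s d s * f s = 0.
  rewrite -[RHS](gf (fun=> 0%N)); apply: eq_bigr => s _.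
  by rewrite big1 ?mulr1.
move: S0; rewrite (bigD1 t)//= big1 => [|s st]; last by rewrite fs ?mulr0.
by rewrite addr0 => /eqP; rewrite mulf_eq0 (negbTE ft) orbF => /eqP.
Qed.

(** * Conjugate partitions *)

Lemma sum_nat_true (a b : nat) (P : nat -> bool) :
  (forall i, (a <= i < b)%N -> P i) -> (\sum_(a <= i < b) P i)%N = (b - a)%N.
Proof.
move=> H; rewrite -[RHS]muln1 -sum_nat_const_nat; apply: eq_big_nat => i.
by move/H => ->.
Qed.

Lemma sum_nat_false (a b : nat) (P : nat -> bool) :
  (forall i, (a <= i < b)%N -> ~~ P i) -> (\sum_(a <= i < b) P i)%N = 0%N.
Proof. by move=> H; rewrite big_nat big1// => i /H /negbTE ->. Qed.

Section Conjugate.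
Variables (n m : nat).
Implicit Types mu nu : Lam n m.

Lemma size_parts mu : size (parts mu) = n.
Proof. by rewrite size_map size_tuple. Qed.

Lemma parts_inj : injective (@parts n m).
Proof. by move=> mu nu /(inj_map val_inj)/val_inj/val_inj. Qed.

Lemma nth_parts_mono mu i : (nth 0%N (parts mu) i.+1 <= nth 0%N (parts mu) i)%N.
Proof.
have [iN|iN] := ltnP i.+1 n; last by rewrite nth_default ?size_parts.
exact: (@parts_sorted _ _ mu (Ordinal (ltnW iN)) (Ordinal iN)).
Qed.

Lemma Lam_mk (s : nat -> nat) : (forall i, (i.+1 < n)%N -> (s i.+1 <= s i)%N) ->
  (forall i, (i < n)%N -> (s i <= m)%N) ->
  exists mu : Lam n m, forall i, (i < n)%N -> nth 0%N (parts mu) i = s i.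
Proof.
move=> smono sm.
have [t tE] : exists t : n.-tuple 'I_m.+1,
    forall i, (i < n)%N -> nth ord0 t i = inord (s i).
  exists [tuple (inord (s i) : 'I_m.+1) | i < n] => i ni.
  have -> : i = Ordinal ni :> nat by [].
  by rewrite nth_mktuple.
have st : sorted (fun a b : 'I_m.+1 => (b <= a)%N) t.
  apply/(sortedP ord0) => i; rewrite size_tuple => ni.
  have ni' := ltnW ni; rewrite (tE _ ni) (tE _ ni') !inordK ?ltnS; last 2 first.
  - exact: sm.
  - exact: sm.
  exact: smono.
exists (exist _ t st) => i ni; rewrite /parts /= (nth_map ord0); last by rewrite size_tuple.
by rewrite tE// inordK// ltnS; exact: sm.
Qed.

Lemma muk_nth mu i : (i < n)%N -> muk mu i.+1 = nth 0%N (parts mu) i.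
Proof. by move=> ni; rewrite /muk /= ni. Qed.

Lemma muk_last mu : muk mu n.+1 = 0%N.
Proof. by rewrite /muk /= ltnn. Qed.

Lemma muk_le mu i : (muk mu i <= m)%N.
Proof. by rewrite /muk; case: eqP => // _; case: ifP => // _; exact: parts_le. Qed.

Lemma muk_mono1 mu i : (muk mu i.+1 <= muk mu i)%N.
Proof.
case: i => [|i]; first exact: muk_le.
rewrite /muk /=; case: ifP => // h; rewrite (ltnW h); exact: nth_parts_mono.
Qed.

Lemma muk_mono mu i j : (i <= j)%N -> (muk mu j <= muk mu i)%N.
Proof.
move=> /subnKC <-; elim: (j - i)%N => [|k IH]; first by rewrite addn0.
by rewrite addnS; apply: leq_trans (muk_mono1 _ _) IH.
Qed.

Definition conjval mu (j : nat) : nat := (\sum_(1 <= i < n.+1) (j < muk mu i))%N.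

Lemma nth_conjpart mu j : nth 0%N (conjpart mu) j = conjval mu j.
Proof.
rewrite /conjpart /conjval.
(* Generalised to the list cut at [N]: removing its leading block lowers the index by the length of
   that block, so the threshold [k + muk mu N] is preserved. *)
have key N k : nth 0%N (flatten [seq nseq (muk mu i - muk mu i.+1) i | i <- rev (iota 0 N)]) k
    = (\sum_(1 <= i < N) (k + muk mu N < muk mu i))%N.
  elim: N k => [|N IH] k; first by rewrite nth_nil big_geq.
  rewrite -addn1 iotaD add0n rev_cat /= nth_cat size_nseq nth_nseq addn1.
  case: ltnP => h.
    rewrite sum_nat_true ?subn1// => i /andP[_ iN].
    by have := muk_mono mu (iN : (i <= N)%N); lia.
  rewrite IH; have := muk_mono1 mu N; case: N h {IH} => [|N] h h'.
    by rewrite !big_geq.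
  rewrite [RHS]big_nat_recr//= (_ : (k + _ < _)%N = false) ?addn0; last by lia.
  by apply: eq_big_nat => i _; congr (nat_of_bool (_ < _)%N); lia.
by rewrite key; under eq_bigr do rewrite muk_last addn0.
Qed.

Lemma conjval_block mu i j : (i <= n)%N -> (muk mu i.+1 <= j)%N -> (j < muk mu i)%N ->
  conjval mu j = i.
Proof.
move=> ni h1 h2; rewrite /conjval (@big_cat_nat _ _ _ i.+1)//=.
rewrite sum_nat_true ?sum_nat_false ?addn0 ?subn1// => k /andP[ik ki].
  by have := muk_mono mu ik; lia.
by have := muk_mono mu (ki : (k <= i)%N); lia.
Qed.

(** The preimage is the conjugate [c] of [l]. Conjugation is involutive because of the equivalence
    [cj]: j < c_i iff i < l_j. *)
Lemma conjval_surj (l : nat -> nat) : (forall j, (j.+1 < m)%N -> (l j.+1 <= l j)%N) ->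
  (forall j, (j < m)%N -> (l j <= n)%N) ->
  exists mu, forall j, (j < m)%N -> conjval mu j = l j.
Proof.
move=> lmono ln.
pose c i := (\sum_(0 <= j < m) (i < l j))%N.
have [|i _|mu muE] := @Lam_mk c.
- by move=> i _; apply: leq_sum => j _; case: (ltnP i.+1) => // h; rewrite (ltnW h).
- apply: (@leq_trans (\sum_(0 <= j < m) 1)%N); last by rewrite sum_nat_const_nat muln1 subn0.
  by apply: leq_sum => j _; case: ltnP.
have lm j k : (j <= k)%N -> (k < m)%N -> (l k <= l j)%N.
  move=> /subnKC <-; elim: (k - j)%N => [|p IH]; first by rewrite addn0.
  by rewrite addnS => h; apply: leq_trans (lmono _ h) (IH (ltnW h)).
exists mu => j jm; rewrite /conjval big_add1 /=.
have cj i : (j < c i)%N = (i < l j)%N.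
  rewrite /c (@big_cat_nat _ _ _ j)//= ?(ltnW jm)//.
  have [h|h] := ltnP i (l j).
    rewrite sum_nat_true => [|k /andP[_ kj]]; last first.
      by apply: leq_trans h _; apply: lm => //; exact: ltnW.
    by rewrite subn0 big_ltn// h; lia.
  rewrite [X in (_ + X)%N]sum_nat_false => [|k /andP[jk km]]; last first.
    by have := lm _ _ jk km; lia.
  apply/negbTE; rewrite -leqNgt addn0.
  apply: (@leq_trans (\sum_(0 <= k < j) 1)%N); last by rewrite sum_nat_const_nat muln1 subn0.
  by apply: leq_sum => k _; case: ltnP.
transitivity (\sum_(0 <= i < n) (i < l j))%N.
  by apply: eq_big_nat => i /andP[_ ni]; rewrite muk_nth// muE// cj.
rewrite (@big_cat_nat _ _ _ (l j))//= ?ln//.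
rewrite sum_nat_true ?sum_nat_false ?addn0 ?subn0// => k /andP[lk _].
by rewrite -leqNgt.
Qed.

Lemma lamZ_inj : injective (@lamZ n m).
Proof. by move=> mu nu /inj_map H; apply: parts_inj; apply: H => a b []. Qed.

Lemma inLam_lamZ mu : inLam n m (lamZ mu).
Proof.
rewrite /inLam size_map size_parts eqxx /=; apply/andP; split.
  apply/(sortedP 0) => i; rewrite size_map => h.
  by rewrite !(nth_map 0%N) ?(ltnW h)// lez_nat nth_parts_mono.
apply/allP => x /mapP[k /(nthP 0%N)[i _ <-] ->].
by rewrite le0z_nat lez_nat parts_le.
Qed.

Lemma lookup_lamZ (R : realType) (psi : Lam n m -> R[i]) mu :
  lookup psi (lamZ mu) = psi mu.
Proof.
rewrite /lookup; case: pickP => [nu /eqP/lamZ_inj ->//|/(_ mu)].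
by rewrite eqxx.
Qed.

Lemma lamZ_shift mu nu i (d : int) : (0 < i <= n)%N ->
  (forall k, (k < n)%N -> (nth 0%N (parts nu) k)%:Z =
     (nth 0%N (parts mu) k)%:Z + (if k == i.-1 then d else 0)) ->
  lamZ nu = Defs.shift (lamZ mu) i d.
Proof.
move=> /andP[i0 ni] H.
have sz (la : Lam n m) : size (lamZ la) = n by rewrite size_map size_parts.
apply: (@eq_from_nth _ 0); first by rewrite size_set_nth !sz; lia.
move=> k; rewrite sz => kn.
have nE (la : Lam n m) j : (j < n)%N -> nth 0 (lamZ la) j = (nth 0%N (parts la) j)%:Z.
  by move=> jn; rewrite (nth_map 0%N) ?size_parts.
rewrite nth_set_nth /= !nE ?H//; last by lia.
by case: eqP => [->|_]; rewrite ?addr0 ?nE//; lia.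
Qed.

Lemma muk_ext mu nu (e : nat -> nat) : e 0%N = m -> e n.+1 = 0%N ->
  (forall k, (k < n)%N -> nth 0%N (parts nu) k = e k.+1) ->
  forall k, (k <= n.+1)%N -> muk nu k = e k.
Proof.
move=> e0 en H [|k] kn; first by rewrite e0.
have [kn'|] := ltnP k n; first by rewrite muk_nth// H.
by move=> nk; have -> : k = n by [lia]; rewrite muk_last en.
Qed.

Lemma Lam_raise mu i : (i < n)%N -> (muk mu i.+1 < muk mu i)%N ->
  exists nu, lamZ nu = Defs.shift (lamZ mu) i.+1 1 /\
    forall k, (k <= n.+1)%N -> muk nu k = (muk mu k + (k == i.+1))%N.
Proof.
move=> ni h.
have [k kn|k kn|nu nuE] := @Lam_mk (fun k => (nth 0%N (parts mu) k + (k == i))%N).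
- have h2 := nth_parts_mono mu k; case: eqP => [e|_]; last by case: eqP; lia.
  by move: h; rewrite muk_nth// -e muk_nth; lia.
- case: eqP => [->|_]; last by rewrite addn0 parts_le.
  by have := muk_le mu i; move: h; rewrite (muk_nth mu ni); lia.
exists nu; split.
  by apply: lamZ_shift => // k kn; rewrite nuE//=; case: eqP => _; lia.
apply: (@muk_ext mu) => [|| k kn]; first by rewrite /muk /= addn0.
  by rewrite muk_last eqSS gtn_eqF.
by rewrite nuE// muk_nth// eqSS.
Qed.

Lemma Lam_lower mu i : (i < n)%N -> (muk mu i.+2 < muk mu i.+1)%N ->
  exists nu, lamZ nu = Defs.shift (lamZ mu) i.+1 (-1) /\
    forall k, (k <= n.+1)%N -> muk nu k = (muk mu k - (k == i.+1))%N.
Proof.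
move=> ni h.
have [k kn|k kn|nu nuE] := @Lam_mk (fun k => (nth 0%N (parts mu) k - (k == i))%N).
- have h2 := nth_parts_mono mu k; case: (k =P i) => [e|_]; last by case: eqP; lia.
  by move: h; rewrite -e !muk_nth//; [lia|rewrite e].
- by have := parts_le mu k; lia.
exists nu; split.
  apply: lamZ_shift => // k kn; rewrite nuE//=; case: eqP => [->|_]; last by lia.
  by move: h; rewrite (muk_nth mu ni); lia.
apply: (@muk_ext mu) => [|| k kn]; first by rewrite /muk /= subn0.
  by rewrite muk_last.
by rewrite nuE// muk_nth// eqSS.
Qed.

Lemma sum_delta (i : nat) (b : bool) : (i < n)%N ->
  (\sum_(1 <= k < n.+1) ((k == i.+1) && b) = b)%N.
Proof.
move=> ni; rewrite (bigD1_seq i.+1) ?iota_uniq ?mem_index_iota//= eqxx big1 ?addn0//.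
by move=> k /negbTE ->.
Qed.

(** In the transposed diagram the new box extends row [muk mu i.+1], the first of the rows of length
    [i]. *)
Lemma conjval_raise mu nu i : (i < n)%N -> (muk mu i.+1 < muk mu i)%N ->
  (forall k, (k <= n.+1)%N -> muk nu k = (muk mu k + (k == i.+1))%N) ->
  forall j, conjval nu j = (if j == muk mu i.+1 then i.+1 else conjval mu j).
Proof.
move=> ni h H j.
have -> : conjval nu j = (conjval mu j + (j == muk mu i.+1))%N.
  rewrite /conjval -(sum_delta (j == _) ni) -big_split /=.
  apply: eq_big_nat => k /andP[_ kn]; rewrite H; last by lia.
  by case: eqP => [->|_] /=; lia.
case: eqP => [->|_]; last by rewrite addn0.
by rewrite (conjval_block (i := i))// ?addn1// ltnW.
Qed.

Lemma conjval_lower mu nu i : (i < n)%N -> (muk mu i.+2 < muk mu i.+1)%N ->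
  (forall k, (k <= n.+1)%N -> muk nu k = (muk mu k - (k == i.+1))%N) ->
  forall j, conjval nu j = (if j == (muk mu i.+1).-1 then i else conjval mu j).
Proof.
move=> ni h H j.
have E : (conjval nu j + (j == (muk mu i.+1).-1) = conjval mu j)%N.
  rewrite /conjval -(sum_delta (j == _) ni) -big_split /=.
  apply: eq_big_nat => k /andP[_ kn]; rewrite H; last by lia.
  by case: eqP => [->|_] /=; lia.
move: E; case: eqP => [->|_]; last by rewrite addn0.
rewrite (conjval_block (i := i.+1) (mu := mu))//; first by rewrite addn1 => -[].
  by lia.
by lia.
Qed.

End Conjugate.

(** * The eigenvalue equation in the alcove *)

Section HopEigen.
Variables (R : realType) (n m : nat) (q pp qp pm qm : R).
Hypothesis n_gt0 : (0 < n)%N.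
Let K := R[i].
Let Q : K := q%:C.
Let ap : K := (pp * qp)%:C.
Let bp : K := (pp + qp)%:C.
Let am : K := (pm * qm)%:C.
Let bm : K := (pm + qm)%:C.
Variables (F : (nat -> int) -> K) (E : K).
Hypothesis Fext : forall l l', (forall j, (j < m)%N -> l j = l' j) -> F l = F l'.
Hypotheses (Rs : rel_swap m Q F) (Rl : rel_left m ap bp F) (Rr : rel_right m n am bm F).
Hypothesis Lap : forall l,
  \sum_(j < m) (F (upd l j (l j + 1)) + F (upd l j (l j - 1))) = E * F l.

Let half (x y : K) : x + x = y + y -> x = y.
Proof. by move/eqP; rewrite -!mulr2n eqrMn2r => /orP[//|/eqP]. Qed.

Lemma swap_adjacent l j a : (j.+1 < m)%N ->
  F (upd2 l j a (a + 1)) = Q * F (upd2 l j (a + 1) a).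
Proof.
move=> jm; have := Rs l a (a + 1) jm; rewrite addrK => H; apply: half.
by apply/eqP; rewrite -subr_eq0 -H; apply/eqP; ring.
Qed.

(** Within a block of equal entries, [swap_adjacent] moves the raised entry one place to the left at
    the cost of a factor q. Lowering a block is the mirror image, with its last entry as
    reference. *)
Lemma block_raise l s k : (s + k < m)%N ->
  (forall j, (s <= j <= s + k)%N -> l j = l s) ->
  F (upd l (s + k)%N (l s + 1)) = Q ^+ k * F (upd l s (l s + 1)).
Proof.
elim: k => [|k IH] km H; first by rewrite addn0 mul1r.
have e1 : l (s + k)%N = l s by apply: H; lia.
have e2 : l (s + k).+1 = l s by apply: H; lia.
rewrite addnS in km *; rewrite exprS -mulrA -IH; [|by lia|by move=> j jk; apply: H; lia].
have -> : upd l (s + k).+1 (l s + 1) = upd2 l (s + k) (l s) (l s + 1).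
  rewrite /upd2; apply/funext => x; rewrite {2}/upd; case: eqP => // ->.
  by rewrite /upd ltn_eqF// e1.
rewrite swap_adjacent//; congr (_ * F _).
apply/funext => x; rewrite /upd2 /upd; case: eqP => // _; case: eqP => // ->.
by rewrite e2.
Qed.

Lemma block_lower l s k : (s + k < m)%N ->
  (forall j, (s <= j <= s + k)%N -> l j = l s) ->
  F (upd l s (l s - 1)) = Q ^+ k * F (upd l (s + k)%N (l s - 1)).
Proof.
elim: k => [|k IH] km H; first by rewrite addn0 mul1r.
have e1 : l (s + k)%N = l s by apply: H; lia.
have e2 : l (s + k).+1 = l s by apply: H; lia.
rewrite addnS in km *; rewrite exprSr -mulrA IH; [|by lia|by move=> j jk; apply: H; lia].
congr (_ * _).
have -> : upd l (s + k)%N (l s - 1) = upd2 l (s + k) (l s - 1) (l s - 1 + 1).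
  rewrite subrK /upd2; apply/funext => x; rewrite /upd; case: eqP => // _.
  by case: eqP => // ->; rewrite e2.
rewrite swap_adjacent//; congr (_ * F _).
apply/funext => x; rewrite /upd2 /upd subrK; case: eqP => [->|//].
by rewrite ltn_eqF// e1.
Qed.

Lemma geometric k : (1 - Q) * \sum_(i < k) Q ^+ i = 1 - Q ^+ k.
Proof. by rewrite -opprB mulNr -subrX1 opprB. Qed.

Variable mu : Lam n m.
Let l (j : nat) : int := (conjval mu j)%:Z.
Let M := muk mu.

Let lblock i j : (i <= n)%N -> (M i.+1 <= j < M i)%N -> l j = i%:Z.
Proof. by move=> ni /andP[h1 h2]; rewrite /l (conjval_block ni h1 h2). Qed.

Lemma sum_blocks (G : nat -> K) N :
  \sum_(0 <= i < N) \sum_(M i.+1 <= j < M i) G j = \sum_(M N <= j < m) G j.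
Proof.
elim: N => [|N IH]; first by rewrite !big_geq.
rewrite big_nat_recr//= IH addrC [RHS](@big_cat_nat _ _ _ (M N))//=.
  exact: muk_mono1.
exact: muk_le.
Qed.

(** Each block contributes a geometric sum times the value with its first entry raised, the move
    matching mu + e_(i+1) for i < n. *)
Lemma sum_raise : (1 - Q) * \sum_(j < m) F (upd l j (l j + 1)) =
  \sum_(0 <= i < n.+1) (1 - Q ^+ (M i - M i.+1)) * F (upd l (M i.+1) (i%:Z + 1)).
Proof.
have -> : \sum_(j < m) F (upd l j (l j + 1)) =
    \sum_(M n.+1 <= j < m) F (upd l j (l j + 1)).
  by rewrite /M muk_last big_mkord.
rewrite -sum_blocks mulr_sumr; apply: eq_big_nat => i /andP[_ ni].
have [h|h] := leqP (M i) (M i.+1).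
  by rewrite big_geq// (_ : (M i - M i.+1 = 0)%N) ?expr0 ?subrr ?mulr0 ?mul0r//; lia.
have ls : l (M i.+1) = i%:Z by apply: lblock; rewrite ?leqnn.
rewrite -geometric -mulrA; congr (_ * _).
rewrite -{1}[M i.+1]add0n big_addn big_mkord mulr_suml; apply: eq_bigr => k _.
have kM := ltn_ord k; have Mm := muk_le mu i.
rewrite addnC (_ : l (M i.+1 + k)%N = l (M i.+1)); last by rewrite ls; apply: lblock => //; lia.
rewrite block_raise ?ls//; first by rewrite /M in kM *; lia.
by move=> j jk; apply: lblock => //; lia.
Qed.

Lemma sum_lower : (1 - Q) * \sum_(j < m) F (upd l j (l j - 1)) =
  \sum_(0 <= i < n.+1) (1 - Q ^+ (M i - M i.+1)) * F (upd l (M i).-1 (i%:Z - 1)).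
Proof.
have -> : \sum_(j < m) F (upd l j (l j - 1)) =
    \sum_(M n.+1 <= j < m) F (upd l j (l j - 1)).
  by rewrite /M muk_last big_mkord.
rewrite -sum_blocks mulr_sumr; apply: eq_big_nat => i /andP[_ ni].
have [h|h] := leqP (M i) (M i.+1).
  by rewrite big_geq// (_ : (M i - M i.+1 = 0)%N) ?expr0 ?subrr ?mulr0 ?mul0r//; lia.
rewrite -geometric -mulrA; congr (_ * _).
rewrite -{1}[M i.+1]add0n big_addn big_mkord mulr_suml.
rewrite [LHS](reindex_inj rev_ord_inj) /=; apply: eq_bigr => k _.
have kM := ltn_ord k; have Mm := muk_le mu i.
set s := (M i - M i.+1 - k.+1 + M i.+1)%N.
have sE : (s + k = (M i).-1)%N by rewrite /s; lia.
have ls : l s = i%:Z by apply: lblock => //; rewrite /s; lia.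
rewrite -sE -ls; apply: block_lower; first by rewrite sE; rewrite /M in kM *; lia.
by move=> j jk; rewrite ls; apply: lblock => //; move: jk; rewrite sE /s; lia.
Qed.

(** [Rz i] raises the first and [Lw i] lowers the last entry of block i. For an empty block these
    points are meaningless, but [A i] is then 0; hence the factor [A] in the identities below. *)
Let A i : K := 1 - Q ^+ (M i - M i.+1).
Let Rz i : K := F (upd l (M i.+1) (i%:Z + 1)).
Let Lw i : K := F (upd l (M i).-1 (i%:Z - 1)).

(** Raising an entry n leaves the alcove. The right relation at k = 0 is twice one expression and
    brings the point back to F(l) and to the first entry lowered; [block_lower] carries the lowering
    to the end of the block. *)
Lemma boundary_right : A n * Rz n = A n * (bm * F l - am * Q ^+ (M n - 1) * Lw n).
Proof.
have M0 : M n.+1 = 0%N := muk_last mu.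
have [h|h] := posnP (M n); first by rewrite /A h sub0n expr0 subrr !mul0r.
have m0 : (0 < m)%N by apply: leq_trans h (muk_le _ _).
have l0 : l 0%N = n%:Z by apply: lblock => //; rewrite M0.
have Rz0 : Rz n = F (upd l 0%N (n%:Z + 1)) by rewrite /Rz M0.
have dbl (x : K) : x = (F (upd l 0%N (n%:Z + 1)) - bm * F (upd l 0%N n%:Z)
    + am * F (upd l 0%N (n%:Z - 1))) -> x = 0.
  by move=> ->; apply: half; rewrite addr0; have := Rr l 0 m0; rewrite ?subr0 ?addr0.
move: dbl.
have -> : upd l 0%N n%:Z = l by rewrite -l0 upd_id.
have -> : F (upd l 0%N (n%:Z - 1)) = Q ^+ (M n - 1) * Lw n.
  rewrite -l0 (@block_lower l 0 (M n - 1)%N) ?add0n /Lw ?l0 -?subn1//.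
    by have := muk_le mu n; rewrite /M in h *; lia.
  by move=> j jn; apply: lblock => //; rewrite M0; lia.
rewrite -Rz0 => /(_ _ erefl) H.
congr (_ * _); apply/eqP; rewrite -subr_eq0 -H; apply/eqP; ring.
Qed.

Lemma boundary_left : A 0 * Lw 0 = A 0 * (bp * F l - ap * Q ^+ (m - M 1 - 1) * Rz 0).
Proof.
have M0 : M 0%N = m by [].
have [h|h] := posnP (m - M 1)%N; first by rewrite /A M0 h expr0 subrr !mul0r.
have m0 : (0 < m)%N by lia.
have lm : l m.-1 = 0 by apply: (@lblock 0) => //; rewrite M0; lia.
have dbl (x : K) : x = (F (upd l m.-1 (0 - 1)) - bp * F (upd l m.-1 0)
    + ap * F (upd l m.-1 (0 + 1))) -> x = 0.
  by move=> ->; apply: half; rewrite addr0; have := Rl l 0 m0; rewrite !oppr0.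
move: dbl.
have -> : upd l m.-1 0 = l by rewrite -lm upd_id.
have l1 : l (M 1%N) = 0 by apply: (@lblock 0) => //; rewrite M0; lia.
have -> : F (upd l m.-1 (0 + 1)) = Q ^+ (m - M 1 - 1) * Rz 0.
  have -> : m.-1 = (M 1%N + (m - M 1 - 1))%N by lia.
  rewrite -{1}l1 block_raise ?l1//; first by lia.
  by move=> j jn; rewrite ?l1; apply: (@lblock 0) => //; rewrite M0; lia.
rewrite -[F (upd l m.-1 (0 - 1))]/(Lw 0) => /(_ _ erefl) H.
congr (_ * _); apply/eqP; rewrite -subr_eq0 -H; apply/eqP; ring.
Qed.

Let phi (nu : Lam n m) : K := F (fun j => (conjval nu j)%:Z).

Lemma hop_raise i (c : R) : (i < n)%N ->
  (if inLam n m (Defs.shift (lamZ mu) i.+1 1)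
   then (c * (1 - q ^+ (M i - M i.+1)))%:C * lookup phi (Defs.shift (lamZ mu) i.+1 1)
   else 0) = c%:C * (A i * Rz i).
Proof.
move=> ni; have -> : (c * (1 - q ^+ (M i - M i.+1)))%:C = c%:C * A i.
  by rewrite rmorphM rmorphB rmorph1 rmorphXn.
have [h|h] := ltnP (M i.+1) (M i); last first.
  by rewrite /A (_ : (M i - M i.+1 = 0)%N) ?expr0 ?subrr ?mul0r ?mulr0 ?mul0r ?if_same//; lia.
have [nu [nuE H]] := Lam_raise ni h.
rewrite -nuE inLam_lamZ lookup_lamZ -mulrA /phi /Rz; congr (_ * (_ * _)).
apply: Fext => j jm; rewrite (conjval_raise ni h H) /upd /l.
by case: eqP => // _; lia.
Qed.

Lemma hop_lower i (c : R) : (i < n)%N ->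
  (if inLam n m (Defs.shift (lamZ mu) i.+1 (-1))
   then (c * (1 - q ^+ (M i.+1 - M i.+2)))%:C * lookup phi (Defs.shift (lamZ mu) i.+1 (-1))
   else 0) = c%:C * (A i.+1 * Lw i.+1).
Proof.
move=> ni; have -> : (c * (1 - q ^+ (M i.+1 - M i.+2)))%:C = c%:C * A i.+1.
  by rewrite rmorphM rmorphB rmorph1 rmorphXn.
have [h|h] := ltnP (M i.+2) (M i.+1); last first.
  by rewrite /A (_ : (M i.+1 - M i.+2 = 0)%N) ?expr0 ?subrr ?mul0r ?mulr0 ?mul0r ?if_same//; lia.
have [nu [nuE H]] := Lam_lower ni h.
rewrite -nuE inLam_lamZ lookup_lamZ -mulrA /phi /Lw; congr (_ * (_ * _)).
apply: Fext => j jm; rewrite (conjval_lower ni h H) /upd /l.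
by case: eqP => // _; lia.
Qed.

(** Among the moves of the Laplacian only raising block n and lowering block 0 leave the alcove. The
    boundary identities replace them by the diagonal term of [Hop] and by corrections to lowering
    block n and raising block 0, which are the factors 1 - alpha q^(...). *)
Lemma Hop_eigen : Hop q pp qp pm qm phi mu = (1 - Q) * E * phi mu.
Proof.
rewrite -[phi mu]/(F l) -mulrA -Lap big_split /= mulrDr sum_raise sum_lower.
have -> : \sum_(0 <= i < n.+1) (1 - Q ^+ (M i - M i.+1)) * F (upd l (M i.+1) (i%:Z + 1))
  = \sum_(0 <= i < n) A i * Rz i + A n * Rz n by rewrite big_nat_recr.
have -> : \sum_(0 <= i < n.+1) (1 - Q ^+ (M i - M i.+1)) * F (upd l (M i).-1 (i%:Z - 1))
  = A 0 * Lw 0 + \sum_(0 <= i < n) A i.+1 * Lw i.+1.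
  by rewrite big_ltn// big_add1.
rewrite boundary_left boundary_right /Hop -/M -/phi.
have -> : \sum_(1 <= i < n.+1 | inLam n m (Defs.shift (lamZ mu) i 1))
      (((if i == 1%N then 1 - pp * qp * q ^+ (m - M 1%N - 1) else 1)
        * (1 - q ^+ (M i.-1 - M i)))%:C * lookup phi (Defs.shift (lamZ mu) i 1))
  = \sum_(0 <= i < n) A i * Rz i - ap * Q ^+ (m - M 1 - 1) * (A 0 * Rz 0).
  rewrite big_mkcond big_add1 /=.
  transitivity (\sum_(0 <= i < n)
     (if i.+1 == 1%N then 1 - pp * qp * q ^+ (m - M 1%N - 1) else 1)%:C * (A i * Rz i)).
    by apply: eq_big_nat => i /andP[_ ni]; exact: hop_raise.
  rewrite !(big_ltn n_gt0) /= rmorphB rmorph1 (rmorphM _ (pp * qp)) rmorphXn -/ap -/Q.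
  rewrite (eq_big_nat _ _ (F2 := fun i => A i * Rz i)); first by ring.
  by case=> // i _; rewrite mul1r.
have -> : \sum_(1 <= i < n.+1 | inLam n m (Defs.shift (lamZ mu) i (-1)))
      (((if i == n then 1 - pm * qm * q ^+ (M n - 1) else 1)
        * (1 - q ^+ (M i - M i.+1)))%:C * lookup phi (Defs.shift (lamZ mu) i (-1)))
  = \sum_(0 <= i < n) A i.+1 * Lw i.+1 - am * Q ^+ (M n - 1) * (A n * Lw n).
  rewrite big_mkcond big_add1 /=.
  transitivity (\sum_(0 <= i < n)
     (if i.+1 == n then 1 - pm * qm * q ^+ (M n - 1) else 1)%:C * (A i.+1 * Lw i.+1)).
    by apply: eq_big_nat => i /andP[_ ni]; exact: hop_lower.
  have [p pn] : exists p, n = p.+1 by exists n.-1; rewrite prednK.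
  have -> : forall G : nat -> K, \sum_(0 <= i < n) G i = \sum_(0 <= i < p) G i + G p.
    by move=> G; rewrite pn big_nat_recr.
  have -> : forall G : nat -> K, \sum_(0 <= i < n) G i = \sum_(0 <= i < p) G i + G p.
    by move=> G; rewrite pn big_nat_recr.
  rewrite -pn eqxx rmorphB rmorph1 (rmorphM _ (pm * qm)) rmorphXn -/am -/Q.
  rewrite (eq_big_nat _ _ (F2 := fun i => A i.+1 * Lw i.+1)); first by ring.
  by move=> i /andP[_ ip]; rewrite pn eqSS ltn_eqF// mul1r.
have -> : ((pp + qp) * (1 - q ^+ (m - M 1%N)) + (pm + qm) * (1 - q ^+ M n))%:C
   = bp * A 0 + bm * A n.
  by rewrite rmorphD !rmorphM !rmorphB rmorph1 !rmorphXn /A /M muk_last subn0.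
rewrite -[phi mu]/(F l); ring.
Qed.

End HopEigen.

(** * Completeness *)

Section Combinations.
Variables (K : numFieldType) (I : finType) (m n : nat).
Variables (F : I -> (nat -> int) -> K) (c : I -> K).
Let G (l : nat -> int) : K := \sum_i c i * F i l.

Lemma rel_swap_sum (q : K) : (forall i, rel_swap m q (F i)) -> rel_swap m q G.
Proof.
move=> H l j a b jm; rewrite /G !mulr_sumr -!(sumrN, big_split) /=; apply: big1 => i _.
rewrite -[RHS](mulr0 (c i)) -(H i l j a b jm); ring.
Qed.

Lemma rel_left_sum (a b : K) : (forall i, rel_left m a b (F i)) -> rel_left m a b G.
Proof.
move=> H l k m0; rewrite /= /G !mulr_sumr -!(sumrN, big_split) /=; apply: big1 => i _.
have /= Hi := H i l k m0; rewrite -[RHS](mulr0 (c i)) -Hi; ring.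
Qed.

Lemma rel_right_sum (a b : K) : (forall i, rel_right m n a b (F i)) -> rel_right m n a b G.
Proof.
move=> H l k m0; rewrite /= /G !mulr_sumr -!(sumrN, big_split) /=; apply: big1 => i _.
have /= Hi := H i l k m0; rewrite -[RHS](mulr0 (c i)) -Hi; ring.
Qed.

End Combinations.

Section OrbitPoints.
Variables (R : realType) (m : nat).
Implicit Types x : 'rV[R]_m.

(** Counting the larger angles recovers the permutation from the values alone, as the angles
    decrease. *)
Lemma ordered_rank x (s : 'S_m) j : ordered_angles x ->
  (\sum_k (x ord0 (s j) < x ord0 (s k))%R)%N = s j :> nat.
Proof.
move=> [_ d].
rewrite (reindex_inj (@perm_inj _ s^-1%g)) /=.
transitivity (\sum_(k < m) (k < s j))%N.
  apply: eq_bigr => k _; rewrite permKV; congr nat_of_bool.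
  have [h|h|h] := ltngtP k (s j).
  - by rewrite d.
  - by apply/negbTE; rewrite -leNgt ltW// d.
  - by rewrite (val_inj h) ltxx.
rewrite -(big_mkord xpredT (fun k => (k < s j)%N : nat)).
rewrite (@big_cat_nat _ _ _ (s j))//=; last exact: ltnW.
by rewrite sum_nat_true ?sum_nat_false ?addn0 ?subn0// => k /andP[h _]; rewrite -leqNgt.
Qed.

(** The cosine of each coordinate gives its angle in ]0, pi[, the sine its sign, and the rank of the
    angle the permutation. *)
Lemma orb_inj x x' (w w' : 'S_m * {ffun 'I_m -> bool}) :
  ordered_angles x -> ordered_angles x' ->
  (forall j, expi (orb x w j) = expi (orb x' w' j)) -> x = x' /\ w = w'.
Proof.
move=> ox ox' H; case: w w' H => [s e] [s' e'] H.
have [r _] := ox; have [r' _] := ox'.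
have sg (b : bool) (t : R) : cos ((if b then -1 else 1) * t) = cos t /\
    sin ((if b then -1 else 1) * t) = (if b then -1 else 1) * sin t.
  by case: b; rewrite ?mul1r ?mulN1r ?cosN ?sinN.
have xs j : x ord0 (s j) = x' ord0 (s' j).
  have [/= e1 _] := expi_inj_re_im (H j); apply: cos_ordered_inj => //.
  by move: e1; rewrite /orb /= !(sg _ _).1.
have ee : e = e'.
  apply/ffunP => j; have [_ /= e1] := expi_inj_re_im (H j).
  move: e1; rewrite /orb /= !(sg _ _).2 xs.
  have := sin_gt0_pi (r' (s' j)).
  by case: (e j); case: (e' j) => //; rewrite !(mul1r, mulN1r) => ? ?; exfalso; lra.
have ss : s = s'.
  apply/permP => j; apply: val_inj => /=.
  rewrite -(ordered_rank s j ox) -(ordered_rank s' j ox').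
  by apply: eq_bigr => k _; rewrite !xs.
split; last by rewrite ss ee.
apply/rowP => k; have := xs (s^-1%g k); rewrite -ss permKV => h.
by rewrite -[x 0 k]/(x ord0 k) h.
Qed.

Lemma expi_neq_real (a t : R) : -1 < a < 1 -> expi t != a%:C.
Proof.
move=> ha; apply/eqP => -[ca sa]; have := cos2Dsin2 t.
rewrite ca sa; move: ha => /andP[]; nra.
Qed.

(** The numerators vanish only at exponentials equal to [pp], [qp] or [q], all off the unit
    circle. *)
Lemma Cfun_neq0 (q pp qp : R) (y : 'I_m -> R) : -1 < q < 1 -> -1 < pp < 1 ->
  -1 < qp < 1 -> exp_regular y -> Cfun q pp qp y != 0.
Proof.
move=> hq hpp hqp [r1 r2]; rewrite CfunE; apply: mulf_neq0.
  apply/prodf_neq0 => j _; have [z1 -> _] := cfac_eq pp qp (r1 j).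
  apply: mulf_neq0; last by rewrite invr_eq0 subr_eq0.
  by apply: mulf_neq0; rewrite subr_eq0; exact: expi_neq_real.
apply/prodf_neq0 => -[j k] /= jk; have jnk : j != k by rewrite -val_eqE /= ltn_eqF.
have [h1 h2] := r2 _ _ jnk.
have [E1 _] := afac_neq q h1; have [E2 _] := afac_neq q h2.
rewrite /gfac E1 E2.
apply: mulf_neq0; apply: mulf_neq0; rewrite ?invr_eq0 subr_eq0;
  [exact: expi_neq_real|exact: h2|exact: expi_neq_real|exact: h1].
Qed.

End OrbitPoints.

(** * Bases and spectra in finite dimension *)

Section LinearAlgebra.

Lemma free_family_spans (K : fieldType) (I T : finType) (b : I -> T -> K) :
  #|I| = #|T| ->
  (forall c : I -> K, (forall x, \sum_i c i * b i x = 0) -> forall i, c i = 0) ->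
  forall f : T -> K, exists c : I -> K, forall x, f x = \sum_i c i * b i x.
Proof.
move=> cIT bfree f.
pose B : 'M[K]_(#|I|, #|T|) := \matrix_(i, x) b (enum_val i) (enum_val x).
have mulB (v : 'rV[K]_#|I|) x :
    (v *m B) ord0 x = \sum_i v ord0 (enum_rank i) * b i (enum_val x).
  rewrite mxE (reindex (@enum_rank I)); last first.
    by apply: onW_bij; exact: enum_rank_bij.
  by apply: eq_bigr => i _; rewrite mxE enum_rankK.
have Bfree : row_free B.
  apply: inj_row_free => v vB; apply/rowP => i; rewrite mxE -(enum_valK i).
  apply: (bfree (fun i => v ord0 (enum_rank i))) => x.
  by rewrite -[x]enum_rankK -mulB vB mxE.
have Bfull : row_full B by rewrite /row_full (eqP Bfree) cIT.
have /submxP[D fD] := submx_full (\row_x f (enum_val x)) Bfull.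
exists (fun i => D ord0 (enum_rank i)) => x.
by rewrite -[x in RHS]enum_rankK -mulB -fD mxE enum_rankK.
Qed.

Variables (R : realType) (I T : finType).
Let K := R[i].

(** Off the eigenvalues, A - l is inverted by dividing coordinates by e_i - l; at an eigenvalue it
    sends the nonzero b_i to 0. *)
Lemma eigenbasis_spectrum (A : (T -> K) -> (T -> K)) (b : I -> T -> K) (e : I -> K) :
  (forall (c : I -> K) (g : I -> T -> K) x,
     A (fun y => \sum_i c i * g i y) x = \sum_i c i * A (g i) x) ->
  is_basis b -> (forall i, A (b i) = fun x => e i * b i x) ->
  spectrum A = range e.
Proof.
move=> Alin [bfree bspan] Ab.
have AE c x : A (fun y => \sum_i c i * b i y) x = \sum_i c i * e i * b i x.
  by rewrite Alin; apply: eq_bigr => i _; rewrite Ab mulrA.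
have hE (l : K) c x : A (fun y => \sum_i c i * b i y) x - l * \sum_i c i * b i x
    = \sum_i c i * (e i - l) * b i x.
  rewrite AE mulr_sumr -sumrB; apply: eq_bigr => i _; ring.
have [co coE] := choice bspan.
have coF f : f = fun x => \sum_i co f i * b i x by apply/funext => x; exact: coE.
apply/seteqP; split=> l /=.
  move=> nb; apply: contrapT => nl; apply: nb.
  have el i : e i - l != 0.
    by rewrite subr_eq0; apply/eqP => ei; apply: nl; exists i.
  pose h (f : T -> K) x := A f x - l * f x.
  have hco f x : h f x = \sum_i co f i * (e i - l) * b i x.
    by rewrite -hE /h -coE -coF.
  have hinj : injective h.
    move=> f g fg.
    have cfg i : (co f i - co g i) * (e i - l) = 0.
      apply: (bfree (fun i => (co f i - co g i) * (e i - l))) => x.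
      transitivity (h f x - h g x); last by rewrite fg subrr.
      by rewrite !hco -sumrB; apply: eq_bigr => k _; ring.
    rewrite (coF f) (coF g); apply/funext => x; apply: eq_bigr => i _.
    have /eqP := cfg i; rewrite mulf_eq0 (negbTE (el i)) orbF subr_eq0.
    by move=> /eqP ->.
  pose g (f : T -> K) x := \sum_i (co f i / (e i - l)) * b i x.
  have hg f : h (g f) = f.
    apply/funext => x; rewrite /h /g hE [RHS]coE.
    by apply: eq_bigr => i _; rewrite divfK.
  by exists g => f; [apply: hinj; rewrite hg|exact: hg].
move=> [i _ <-] [g gK _]; set h := (fun f x => _) in gK.
have h0 : h (b i) = h (fun=> 0).
  (* Linearity is known only for finite combinations, so 0 is written as one. *)
  have z0 : (fun=> 0 : K) = (fun x => \sum_(j : I) 0 * b j x).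
    by apply/funext => x; rewrite big1// => j _; rewrite mul0r.
  apply/funext => x; rewrite /h Ab subrr {1}z0 AE mulr0 subr0 big1// => j _.
  by rewrite !mul0r.
have bi0 : b i = fun=> 0 by rewrite -(gK (b i)) h0 gK.
have H x : \sum_j (j == i)%:R * b j x = 0.
  rewrite (bigD1 i)//= bi0 mulr0 big1 ?addr0// => j /negbTE ->; exact: mul0r.
by have /eqP := bfree _ H i; rewrite eqxx oner_eq0.
Qed.

End LinearAlgebra.

Section HopLinear.
Variables (R : realType) (n m : nat) (q pp qp pm qm : R) (I : finType).

Lemma Hop_sum (c : I -> R[i]) (g : I -> Lam n m -> R[i]) mu :
  Hop q pp qp pm qm (fun nu => \sum_i c i * g i nu) mu
  = \sum_i c i * Hop q pp qp pm qm (g i) mu.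
Proof.
have lk s : lookup (fun nu => \sum_i c i * g i nu) s = \sum_i c i * lookup (g i) s.
  rewrite /lookup; case: pickP => // _; rewrite big1// => i _; exact: mulr0.
rewrite /Hop; under [in RHS]eq_bigr => i _ do rewrite 2!(mulrDr (c i)).
rewrite !big_split /=; congr (_ + _ + _).
- by rewrite mulr_sumr; apply: eq_bigr => i _; rewrite mulrCA.
- under [in RHS]eq_bigr do rewrite mulr_sumr.
  rewrite exchange_big /=; apply: eq_bigr => k _.
  by rewrite lk mulr_sumr; apply: eq_bigr => i _; rewrite mulrCA.
- under [in RHS]eq_bigr do rewrite mulr_sumr.
  rewrite exchange_big /=; apply: eq_bigr => k _.
  by rewrite lk mulr_sumr; apply: eq_bigr => i _; rewrite mulrCA.
Qed.

End HopLinear.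

(** A choice of preimages under conjugation is injective; exchanging [m] and [n] then gives
    equality. *)
Lemma leq_card_Lam n m : (#|{: Lam m n}| <= #|{: Lam n m}|)%N.
Proof.
have ex (kappa : Lam m n) : exists mu : Lam n m, forall j, (j < m)%N ->
    conjval mu j = nth 0%N (parts kappa) j.
  by apply: conjval_surj => j _; [exact: nth_parts_mono|exact: parts_le].
have [f fE] := choice ex; apply: (@leq_card _ _ f) => k k' e.
apply: parts_inj; apply: (@eq_from_nth _ 0%N); first by rewrite !size_parts.
by move=> j; rewrite size_parts => jm; rewrite -!fE// e.
Qed.

Lemma card_Lam n m : #|{: Lam m n}| = #|{: Lam n m}|.
Proof. by apply/eqP; rewrite eqn_leq !leq_card_Lam. Qed.

Lemma wave_ext (R : realType) (m : nat) (q pp qp : R) (x : 'rV[R]_m) (l l' : nat -> int) :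
  (forall j, (j < m)%N -> l j = l' j) -> wave q pp qp x l = wave q pp qp x l'.
Proof.
by move=> H; apply: eq_bigr => w _; congr (_ * _); apply: eq_bigr => j _; rewrite H.
Qed.

(** * The Bethe eigenbasis *)

Section BetheBasis.
Variables (R : realType) (m n : nat) (q pp qp pm qm : R).
Hypotheses (n_gt0 : (0 < n)%N) (hq : -1 < q < 1) (hpp : -1 < pp < 1)
  (hqp : -1 < qp < 1) (hpm : -1 < pm < 1) (hqm : -1 < qm < 1).
Variable xi : Lam m n -> 'rV[R]_m.
Hypothesis xi_bethe : forall kappa, bethe_vector q pp qp pm qm kappa (xi kappa).
Let K := R[i].
Let F (kappa : Lam m n) := wave q pp qp (xi kappa).

Lemma bethe_ordered kappa : ordered_angles (xi kappa).
Proof.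
split=> [j|j k jk]; last exact: (bethe_vector_decr hq hpp hqp hpm hqm (xi_bethe kappa)).
by rewrite (bethe_vector_gt0 hq hpp hqp hpm hqm (xi_bethe kappa))
  (bethe_vector_ltpi hq hpp hqp hpm hqm (xi_bethe kappa)).
Qed.

Lemma bethe_exp_regular kappa : exp_regular (xi kappa ord0).
Proof. exact/ordered_exp_regular/bethe_ordered. Qed.

Lemma bethe_phase1 kappa (j : 'I_m) :
  expi (bethe_phase n q pp qp pm qm (xi kappa) j) = 1 :> K.
Proof. by rewrite xi_bethe; exact: (@expi_2pi R (m - j + nth 0%N (parts kappa) j)%N%:Z). Qed.

Lemma bethe_rel_right kappa : rel_right m n (pm * qm)%:C (pm + qm)%:C (F kappa).
Proof.
apply: wave_rel_right => //; [exact: bethe_exp_regular|exact: bethe_phase1].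
Qed.

Lemma psi_wave kappa (mu : Lam n m) :
  psi q pp qp (xi kappa) mu = F kappa (fun j => (conjval mu j)%:Z).
Proof.
rewrite /psi (Rfun_regular _ _ _ _ (bethe_exp_regular kappa)) Rreg_wave.
by apply: wave_ext => j _; rewrite nth_conjpart.
Qed.

Lemma psi_eigen kappa : Hop q pp qp pm qm (psi q pp qp (xi kappa))
  = fun mu : Lam n m => (Een q (xi kappa))%:C * psi q pp qp (xi kappa) mu.
Proof.
have psiE : psi q pp qp (xi kappa) =
    fun mu : Lam n m => F kappa (fun j => (conjval mu j)%:Z).
  by apply/funext => mu; exact: psi_wave.
rewrite psiE; apply/funext => mu.
have rx := bethe_exp_regular kappa.
have rs : rel_swap m q%:C (F kappa) by exact: wave_rel_swap.
have rl : rel_left m (pp * qp)%:C (pp + qp)%:C (F kappa) by exact: wave_rel_left.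
have ext l l' : (forall j, (j < m)%N -> l j = l' j) -> F kappa l = F kappa l'.
  exact: wave_ext.
have lap := wave_laplace q pp qp (xi kappa).
rewrite (Hop_eigen n_gt0 ext rs rl (bethe_rel_right kappa) lap).
congr (_ * _).
have -> : Een q (xi kappa) = (1 - q) * (2 * \sum_(j < m) cos (xi kappa ord0 j)).
  by rewrite /Een; ring.
by rewrite [RHS]rmorphM rmorphB rmorph1.
Qed.

Lemma bethe_inj kappa kappa' : xi kappa = xi kappa' -> kappa = kappa'.
Proof.
by move=> e; apply: (bethe_vector_inj (xi_bethe kappa)); rewrite e.
Qed.

Lemma psi_free (c : Lam m n -> K) :
  (forall mu : Lam n m, \sum_kappa c kappa * psi q pp qp (xi kappa) mu = 0) ->
  forall kappa, c kappa = 0.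
Proof.
move=> H.
pose G (l : nat -> int) : K := \sum_kappa c kappa * F kappa l.
have Gext l l' : (forall j, (j < m)%N -> l j = l' j) -> G l = G l'.
  by move=> ll'; apply: eq_bigr => k _; rewrite /F (wave_ext _ _ _ _ ll').
have G0 l : G l = 0.
  move: l; apply: (@relations_vanish _ m n q%:C (pp * qp)%:C (pp + qp)%:C
     (pm * qm)%:C (pm + qm)%:C G n_gt0).
  - by apply: rel_swap_sum => k; apply: wave_rel_swap; exact: bethe_exp_regular.
  - by apply: rel_left_sum => k; apply: wave_rel_left; exact: bethe_exp_regular.
  - by apply: rel_right_sum => k; exact: bethe_rel_right.
  - move=> l [lmono lrange].
    (* Every alcove point is the conjugate of some [mu], where the assumed dependence applies. *)
    have [j jm|j jm|mu muE] := @conjval_surj n m (fun j => `|l j|%N).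
    + move: (lmono j jm) (lrange _ jm) (lrange _ (ltnW jm)).
      by move: (l j) (l j.+1); clear; lia.
    + by move: (lrange _ jm); move: (l j); clear; lia.
    rewrite -[RHS](H mu) -(Gext (fun j => (conjval mu j)%:Z)).
      by apply: eq_bigr => k _; rewrite psi_wave.
    by move=> j jm; rewrite muE//; move: (lrange _ jm); move: (l j); clear; lia.
pose T := (Lam m n * ('S_m * {ffun 'I_m -> bool}))%type.
have D0 := @exponentials_free K m T
  (fun t j => expi (orb (xi t.1) t.2 j))
  (fun t => c t.1 * Cfun q pp qp (orb (xi t.1) t.2)).
move=> kappa.
(* The exponentials are indexed by all pairs (kappa, w); the coefficient at w = 1 already determines
   [c kappa]. *)
have {}D0 : c kappa * Cfun q pp qp (orb (xi kappa) (1%g, [ffun=> false])) = 0.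
  apply: (D0 _ _ (kappa, (1%g, [ffun=> false]))).
    move=> [k w] [k' w'] /= e.
    have [ek ew] := orb_inj (bethe_ordered k) (bethe_ordered k') e.
    by rewrite ew (bethe_inj ek).
  move=> l; rewrite -[RHS](G0 (fun j => if insub j is Some i then (l i)%:Z else 0)).
  rewrite /G /F /wave; under [in RHS]eq_bigr do rewrite mulr_sumr.
  rewrite pair_big /=; apply: eq_bigr => -[k w] _ /=; rewrite mulrA; congr (_ * _).
  by apply: eq_bigr => j _; rewrite valK.
move/eqP: D0; rewrite mulf_eq0 => /orP[/eqP//|].
by rewrite (negbTE (Cfun_neq0 hq hpp hqp (orb_regular (bethe_exp_regular kappa) _))).
Qed.

Lemma psi_basis : is_basis (fun kappa : Lam m n => @psi R n m q pp qp (xi kappa)).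
Proof.
split; first exact: psi_free.
apply: free_family_spans; first exact: card_Lam.
exact: psi_free.
Qed.

End BetheBasis.

Unset Implicit Arguments.
Set Strict Implicit.
Set Printing Implicit Defensive.

Theorem theorem4p2 (R : realType) (m n : nat) (q pp qp pm qm : R)
  (hn : (0 < n)%N)
  (hq : -1 < q < 1) (hq0 : q != 0)
  (hpp : -1 < pp < 1) (hpp0 : pp != 0)
  (hqp : -1 < qp < 1) (hqp0 : qp != 0)
  (hpm : -1 < pm < 1) (hpm0 : pm != 0)
  (hqm : -1 < qm < 1) (hqm0 : qm != 0)
  (xi : Lam m n -> 'rV[R]_m)
  (hxi : forall (kappa : Lam m n) (x : 'rV[R]_m),
      Vmorse q pp qp pm qm kappa (xi kappa) <= Vmorse q pp qp pm qm kappa x) :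
  spectrum (@Hop R n m q pp qp pm qm)
    = range (fun kappa : Lam m n => (Een q (xi kappa))%:C)
  /\ is_basis (fun kappa : Lam m n => (@psi R n m q pp qp (xi kappa)))
  /\ (forall kappa : Lam m n,
        Hop q pp qp pm qm (psi q pp qp (xi kappa))
        = fun mu : Lam n m => (Een q (xi kappa))%:C * psi q pp qp (xi kappa) mu).
Proof.
have xi_bethe kappa : bethe_vector q pp qp pm qm kappa (xi kappa).
  exact: minimizer_bethe_vector (hxi kappa).
have basis := psi_basis hn hq hpp hqp hpm hqm xi_bethe.
have eigen := psi_eigen hn hq hpp hqp hpm hqm xi_bethe.
split; last by split.
apply: eigenbasis_spectrum basis eigen.
by move=> c g mu; exact: Hop_sum.
Qed.
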